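(* Let $\lambda_{BS}>0$, $p\in(0,1)$, $P_{macro},P_{micro}>0$, $\beta>2$, $\lambda_{SU}>0$. Let $\Phi_{macro},\Phi_{micro}$ be independent homogeneous Poisson point processes on $\mathbb{R}^2$ of intensities $p\lambda_{BS}$ and $(1-p)\lambda_{BS}$, and $\mathcal{U}_{static}$ an independent homogeneous Poisson point process of intensity $\lambda_{SU}$ (static users). Let $\overline N_{SU,het}=\mathbf{E}^0_{SU}[|\mathcal{U}_{static}(V_{het}(0))|]$, where under the Palm distribution $\mathbf{E}^0_{SU}$ of the static users (a typical static user at the origin), $V_{het}(0)$ is the hetnet cell containing the origin. Then, writing $x=(x_1,x_2)$, $y=(y_1,y_2)$, $$\overline N_{SU,het}=1+\lambda_{SU}\lambda_{BS}p\int_{\mathbb{R}^4}e^{-\lambda_{BS}p\,\mathcal{A}(x,y)}e^{-\lambda_{BS}(1-p)\mathcal{B}(x,y)}\,dx\,dy+\lambda_{SU}\lambda_{BS}(1-p)\int_{\mathbb{R}^4}e^{-\lambda_{BS}(1-p)\mathcal{A}(x,y)}e^{-\lambda_{BS}p\,\mathcal{D}(x,y)}\,dx\,dy,$$ where $\mathcal{A}(x,y)$, $\mathcal{B}(x,y)$, $\mathcal{D}(x,y)$ are the areas of the union of the disc centered at $x$ and the disc centered at $y$ with radii, respectively, $(|x|,|y|)$, $\big((P_{micro}/P_{macro})^{1/\beta}|x|,(P_{micro}/P_{macro})^{1/\beta}|y|\big)$, and $\big((P_{macro}/P_{micro})^{1/\beta}|x|,(P_{macro}/P_{micro})^{1/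\beta}|y|\big)$.
   Context: With $\Phi=\Phi_{macro}\cup\Phi_{micro}$ and $P_i=P_{macro}$ for macro stations, $P_i=P_{micro}$ for micro stations, the hetnet cell of a station $X_i\in\Phi$ is the set of $z\in\mathbb{R}^2$ with $P_i|X_i-z|^{-\beta}\ge P_j|X_j-z|^{-\beta}$ for all $X_j\in\Phi$; static users are served by the station whose hetnet cell contains them. $|\mathcal{U}_{static}(B)|$ is the number of static users in $B$ (including the typical one). *)

(* Defs.v *)
From HB Require Import structures.
From mathcomp Require Import all_boot all_order all_algebra.
From mathcomp Require Import all_classical all_reals all_analysis.
From mathcomp Require Import measurable_realfun.
Set Implicit Arguments. Unset Strict Implicit. Unset Printing Implicit Defensive.
Import Order.TTheory GRing.Theory Num.Theory.
Import numFieldNormedType.Exports.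
Local Open Scope classical_set_scope.
Local Open Scope ring_scope.

Section defs.
Variable R : realType.

Local Notation pt := (R * R)%type.

Definition leb2 := (@lebesgue_measure R \x @lebesgue_measure R)%E.

Definition leb4 := (leb2 \x leb2)%E.

Definition dist2 (x y : pt) : R :=
  Num.sqrt ((x.1 - y.1) ^+ 2 + (x.2 - y.2) ^+ 2).

Definition normpt (x : pt) : R := dist2 x (0, 0).

Definition disc (c : pt) (r : R) : set pt := [set z | dist2 c z <= r].

Definition npts (S : set pt) (B : set pt) : \bar R :=
  (\esum_(z in S `&` B) 1)%E.

Definition poisson_law (m : R) (k : nat) : R :=
  m ^+ k / k`!%:R * expR (- m).

Definition indep_hPPPs d (Omega : measurableType d) (P : probability Omega R)
    (n : nat) (Phi : 'I_n -> Omega -> set pt) (lam : 'I_n -> R) : Prop :=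
  (forall i (B : set pt), measurable B ->
     measurable_fun setT (fun w => npts (Phi i w) B)) /\
  (forall (m : nat) (idx : 'I_m -> 'I_n) (B : 'I_m -> set pt) (k : 'I_m -> nat),
     (forall j, measurable (B j) /\ (leb2 (B j) < +oo)%E) ->
     (forall j j', j != j' -> idx j = idx j' -> B j `&` B j' = set0) ->
     P (\bigcap_(j in [set: 'I_m])
          [set w | npts (Phi (idx j) w) (B j) = ((k j)%:R)%:E]) =
     (\prod_(j < m) poisson_law (lam (idx j) * fine (leb2 (B j))) (k j))%:E).

Definition shift (S : set pt) (u : pt) : set pt :=
  [set z | S (z.1 + u.1, z.2 + u.2)].

Definition beats (beta PX PY : R) (X Y z : pt) : Prop :=
  PX * dist2 X z `^ (- beta) >= PY * dist2 Y z `^ (- beta).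

Definition hetcell (beta Pmac Pmic : R) (Phimac Phimic : set pt)
    (X : pt) (PX : R) : set pt :=
  [set z | (forall Y, Phimac Y -> beats beta PX Pmac X Y z) /\
           (forall Y, Phimic Y -> beats beta PX Pmic X Y z)].

(* the hetnet cell containing the location z0 (union of the cells of the
   stations whose cell contains z0; a.s. a single cell) *)
Definition hetcell_at (beta Pmac Pmic : R) (Phimac Phimic : set pt)
    (z0 : pt) : set pt :=
  [set z | exists X,
     (Phimac X /\ hetcell beta Pmac Pmic Phimac Phimic X Pmac z0 /\
                  hetcell beta Pmac Pmic Phimac Phimic X Pmac z) \/
     (Phimic X /\ hetcell beta Pmac Pmic Phimac Phimic X Pmic z0 /\
                  hetcell beta Pmac Pmic Phimac Phimic X Pmic z)].

(* Palm expectation w.r.t. the stationary point process U of intensity lamU of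
   a functional F of the (macro, micro, user) configurations, defined by the
   Campbell-Mecke formula with the unit square as reference window:
   E^0_U[F] = 1/(lamU |B|) E[ sum_{u in U cap B} F(theta_u) ], |B| = 1. *)
Definition unit_square : set pt :=
  [set z | (0 <= z.1 <= 1) /\ (0 <= z.2 <= 1)].

Definition palmE d (Omega : measurableType d) (P : probability Omega R)
    (Phimac Phimic U : Omega -> set pt) (lamU : R)
    (F : set pt -> set pt -> set pt -> \bar R) : \bar R :=
  ((lamU^-1)%:E * \int[P]_w
     (\esum_(u in U w `&` unit_square)
        F (shift (Phimac w) u) (shift (Phimic w) u) (shift (U w) u)))%E.

Definition users_in_cell0 (beta Pmac Pmic : R)
    (Phimac Phimic U : set pt) : \bar R :=
  npts U (hetcell_at beta Pmac Pmic Phimac Phimic (0, 0)).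

Definition union_area (a : R) (x y : pt) : R :=
  fine (leb2 (disc x (a * normpt x) `|` disc y (a * normpt y))).

End defs.

(* Main.v *)
Require Import Defs.
From HB Require Import structures.
From mathcomp Require Import all_boot all_order all_algebra.
From mathcomp Require Import all_classical all_reals all_analysis.
From mathcomp Require Import measurable_realfun.
From mathcomp Require Import ring lra zify.
Set Implicit Arguments. Unset Strict Implicit. Unset Printing Implicit Defensive.
Import Order.TTheory GRing.Theory Num.Theory.
Import numFieldNormedType.Exports.
Local Open Scope classical_set_scope.
Local Open Scope ring_scope.

(** Multiplied by [lamSU], the Palm expectation is the mean number of pairs of
    users (u, v), u in the unit square, lying in the cell of a common station X.
    The diagonal pairs contribute [lamSU].  For u <> v, X reaches both exactly
    when, for either tier, the union of the two discs around u and v through X,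
    rescaled by the ratio of the powers, contains no station in its interior;
    the weight of a triple (X, u, v) is therefore the product of two void
    probabilities.

    The Palm formula for such triples is obtained directly from the joint law of
    the counts.  Cut a window into square mesh cells.  For each triple of cells,
    the event that each of them contains exactly one point and that the unions
    of discs, slightly enlarged or shrunk and with cells of the triple cut out,
    are void has an explicit probability.  The number of such events bounds the
    number of pairs from below (enlarged discs, cells pairwise distinct) and, in
    the limit of a fine mesh, from above (shrunk discs, by Fatou's lemma).  Both
    expected counts are Riemann sums of the same integral over (X, u, v), and
    moving X to the origin by translation leaves the integral over R^4 times the
    area of the unit square.

    Measurability of the number of pairs itself is never needed: the integral of
    a nonnegative function is a supremum over simple functions, so that it is
    monotone anyway. *)

(** The joint law factorises only over sets that are disjoint within one process, and this shapes
    every event: the cell of the station has to be cut out of the void region of its own tier, and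
    the two user cells have to differ, so that diagonal pairs need events of their own.

    A station lying exactly at a user has received power zero there, because [powR] sends the base
    zero with exponent [- beta] to zero. It imposes no constraint on the other stations at that
    user. The upper events therefore cut the cells of the users out of the void regions, while the
    lower events avoid the degenerate case by taking three distinct cells. Each cut costs an area of
    order [mesh ^+ 2], which vanishes in the limit.

    There are two limits, the mesh inside a window first and the window afterwards. In a window the
    positions have finite measure and dominated convergence applies; the integral over the whole
    space is then reached by monotone convergence. *)

Local Notation R1 := measurableTypeR.

(** * Products of planar Lebesgue measures and translations *)

Section prodm.
Local Open Scope ereal_scope.
Context d1 d2 (T1 : measurableType d1) (T2 : measurableType d2) (R : realType).
Variable m1 : {sigma_finite_measure set T1 -> \bar R}.
Variable m2 : {sigma_finite_measure set T2 -> \bar R}.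

Definition prodm := m1 \x m2.

HB.instance Definition _ := Measure.on prodm.

Let prodm_sigma_finite : sigma_finite setT prodm.
Proof.
have [F FT Foo] := sigma_finiteT m1; have [G GT Goo] := sigma_finiteT m2.
(* Pairs of indices are enumerated through [unpickle]; a code of no pair falls back on [(0, 0)],
   which only repeats one piece. *)
pose f k := let ij := odflt (0%N, 0%N) (unpickle k) in F ij.1 `*` G ij.2.
exists f => [|k].
  apply/seteqP; split => // -[x y] _.
  have [i _ Fx] : (\bigcup_k F k) x by rewrite -FT.
  have [j _ Gy] : (\bigcup_k G k) y by rewrite -GT.
  by exists (pickle (i, j)) => //; rewrite /f pickleK.
have [mF Fk] := Foo (odflt (0%N, 0%N) (unpickle k)).1.
have [mG Gk] := Goo (odflt (0%N, 0%N) (unpickle k)).2.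
split; first exact: measurableX.
by rewrite /prodm product_measure1E// lte_mul_pinfty// ge0_fin_numE.
Qed.

HB.instance Definition _ := Measure_isSigmaFinite.Build _ _ _ prodm
  prodm_sigma_finite.
End prodm.

HB.instance Definition _ (R : realType) := SigmaFiniteMeasure.copy (@leb2 R)
  (prodm (@lebesgue_measure R) (@lebesgue_measure R)).
HB.instance Definition _ (R : realType) := SigmaFiniteMeasure.copy (@leb4 R)
  (prodm (@leb2 R) (@leb2 R)).
(** Positions of a triple: the station in the first factor, the pair of users in the second. *)
Definition leb6 (R : realType) := prodm (@leb2 R) (@leb4 R).
HB.instance Definition _ (R : realType) := SigmaFiniteMeasure.on (@leb6 R).

Lemma leb2X (R : realType) (A B : set (R1 R)) : measurable A -> measurable B ->
  leb2 (A `*` B) = (lebesgue_measure A * lebesgue_measure B)%E.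
Proof. exact: product_measure1E. Qed.
Lemma leb4X (R : realType) (A B : set (R1 R * R1 R)) : measurable A -> measurable B ->
  leb4 (A `*` B) = (leb2 A * leb2 B)%E.
Proof. exact: product_measure1E. Qed.
Lemma leb6X (R : realType) (A : set (R1 R * R1 R)) B : measurable A -> measurable B ->
  leb6 (A `*` B) = (leb2 A * leb4 B)%E.
Proof. exact: product_measure1E. Qed.

Definition invariant_under d (T : measurableType d) (R : realType)
    (mu : set T -> \bar R) (phi : T -> T) :=
  forall A, measurable A -> mu (phi @^-1` A) = mu A.

Section invariance.
Local Open Scope ereal_scope.

Lemma invariant_integral d (T : measurableType d) (R : realType)
    (mu : {measure set T -> \bar R}) (phi : T -> T) (f : T -> \bar R) :
  measurable_fun setT phi -> invariant_under mu phi ->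
  measurable_fun setT f -> (forall x, 0 <= f x) ->
  \int[mu]_x f (phi x) = \int[mu]_x f x.
Proof.
move=> mphi inv mf f0.
pose g : {mfun T >-> T} := HB.pack phi (isMeasurableFun.Build _ _ _ _ _ mphi).
transitivity (\int[pushforward mu g]_x f x).
  by rewrite ge0_integral_pushforward.
by apply: eq_measure_integral => A mA _; exact: inv.
Qed.

(** The pushforward of the product agrees with the product on rectangles, and these determine a
    product measure. *)
Lemma invariant_prodm d1 d2 (T1 : measurableType d1) (T2 : measurableType d2)
    (R : realType) (m1 : {sigma_finite_measure set T1 -> \bar R})
    (m2 : {sigma_finite_measure set T2 -> \bar R}) (f1 : T1 -> T1) (f2 : T2 -> T2) :
  measurable_fun setT f1 -> measurable_fun setT f2 ->
  invariant_under m1 f1 -> invariant_under m2 f2 ->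
  invariant_under (prodm m1 m2) (fun x => (f1 x.1, f2 x.2)).
Proof.
move=> mf1 mf2 i1 i2 A mA.
have mg : measurable_fun setT (fun x : T1 * T2 => (f1 x.1, f2 x.2)).
  by apply/measurable_fun_pair; exact: measurableT_comp.
pose g : {mfun (T1 * T2)%type >-> (T1 * T2)%type} :=
  HB.pack (fun x : T1 * T2 => (f1 x.1, f2 x.2)) (isMeasurableFun.Build _ _ _ _ _ mg).
apply/esym.
apply: (@product_measure_unique _ _ _ _ _ m1 m2 (pushforward (prodm m1 m2) g)) => // B C mB mC.
suff : prodm m1 m2 ((f1 @^-1` B) `*` (f2 @^-1` C)) = m1 B * m2 C by [].
have mB' : measurable (f1 @^-1` B) by rewrite -[X in measurable X]setTI; exact: mf1.
have mC' : measurable (f2 @^-1` C) by rewrite -[X in measurable X]setTI; exact: mf2.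
by rewrite [LHS]product_measure1E// -(i1 B)// -(i2 C).
Qed.

End invariance.

Section translations.
Variable R : realType.
Local Notation pt := (R1 R * R1 R)%type.
Lemma measurable_dist2 : measurable_fun setT (fun xy : pt * pt => dist2 xy.1 xy.2 : R).
Proof.
rewrite /dist2. apply: (measurableT_comp (continuous_measurable_fun (@sqrt_continuous R))).
have f1 : measurable_fun setT (fun xy : pt * pt => xy.1.1 : R) by exact: measurableT_comp.
have f2 : measurable_fun setT (fun xy : pt * pt => xy.1.2 : R) by exact: measurableT_comp.
have f3 : measurable_fun setT (fun xy : pt * pt => xy.2.1 : R) by exact: measurableT_comp.
have f4 : measurable_fun setT (fun xy : pt * pt => xy.2.2 : R) by exact: measurableT_comp.
by apply: measurable_funD; apply: measurable_funX; apply: measurable_funB.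
Qed.

Local Open Scope ereal_scope.
(** The pushforward agrees with Lebesgue measure on half-open intervals, and these determine it. *)
Lemma invariant_leb1 (c : R) :
  invariant_under (@lebesgue_measure R) (fun x : R => (x + c)%R).
Proof.
have mphi : measurable_fun setT (fun x : R1 R => (x + c)%R : R1 R).
  exact: measurable_funD.
pose g : {mfun R1 R >-> R1 R} :=
  HB.pack (fun x : R1 R => (x + c)%R : R1 R) (isMeasurableFun.Build _ _ _ _ _ mphi).
move=> A mA; apply/esym.
apply: (lebesgue_measure_unique (mu := pushforward (@lebesgue_measure R) g)) => //.
move=> _ [[a b] _ <-] /=; rewrite /pushforward.
have -> : +%R^~ c @^-1` `]a, b] = [set` `]a - c, b - c]%R].
  by apply/seteqP; split => x /=; rewrite !in_itv/= ltrBlDr lerBrDr.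
rewrite !lebesgue_measure_itv/= !lte_fin ltrD2r; case: ifP => // _.
by rewrite -!EFinB opprB addrA subrK.
Qed.

Definition translate (c x : pt) : pt := (x.1 + c.1, x.2 + c.2)%R.

Lemma measurable_translate c : measurable_fun setT (translate c).
Proof.
apply/measurable_fun_pair.
  by apply: (@measurable_funD _ _ R _ (fun x : pt => x.1)) => //; exact: measurable_fst.
by apply: (@measurable_funD _ _ R _ (fun x : pt => x.2)) => //; exact: measurable_snd.
Qed.

Lemma invariant_leb2 c : invariant_under (@leb2 R) (translate c).
Proof.
have m1 (e : R) : measurable_fun setT (fun x : R1 R => (x + e)%R : R1 R).
  exact: measurable_funD.
exact: (@invariant_prodm _ _ _ _ R (@lebesgue_measure R) (@lebesgue_measure R)
  _ _ (m1 c.1) (m1 c.2) (invariant_leb1 _) (invariant_leb1 _)).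
Qed.

Lemma invariant_leb4 c :
  invariant_under (@leb4 R) (fun x => (translate c x.1, translate c x.2)).
Proof.
by apply: invariant_prodm; [exact: measurable_translate..| |]; exact: invariant_leb2.
Qed.
End translations.

(** * Discs in the plane *)

Section plane.
Variable R : realType.
Local Notation pt := (R1 R * R1 R)%type.
Implicit Types (x y z u v : pt) (r s : R).

Lemma dist2_ge0 x y : 0 <= dist2 x y.
Proof. exact: sqrtr_ge0. Qed.

Lemma dist2C x y : dist2 x y = dist2 y x.
Proof. by rewrite /dist2; congr (Num.sqrt _); ring. Qed.

Lemma dist2xx x : dist2 x x = 0.
Proof. by rewrite /dist2 !subrr expr0n/= addr0 sqrtr0. Qed.

Lemma dist2_sqr x y : dist2 x y ^+ 2 = (x.1 - y.1) ^+ 2 + (x.2 - y.2) ^+ 2.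
Proof. by rewrite sqr_sqrtr// addr_ge0// sqr_ge0. Qed.

Lemma dist2_eq0 x y : dist2 x y = 0 -> x = y.
Proof.
move=> d0; have := dist2_sqr x y; rewrite d0 expr0n/= => /esym/eqP.
rewrite paddr_eq0 ?sqr_ge0// !sqrf_eq0 !subr_eq0.
by case: x y {d0} => [? ?] [? ?] /= /andP[/eqP -> /eqP ->].
Qed.

Lemma dist2_gt0 x y : x <> y -> 0 < dist2 x y.
Proof. by move=> xy; rewrite lt0r dist2_ge0 andbT; apply/eqP => /dist2_eq0. Qed.

Lemma dist2_triangle y x z : dist2 x z <= dist2 x y + dist2 y z.
Proof.
rewrite -(@ler_pXn2r _ 2)// ?nnegrE ?addr_ge0 ?dist2_ge0//.
rewrite sqrrD !dist2_sqr.
suff : (x.1 - y.1) * (y.1 - z.1) + (x.2 - y.2) * (y.2 - z.2) <= dist2 x y * dist2 y z.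
  by move=> h; nra.
apply: (le_trans (ler_norm _)).
rewrite -sqrtr_sqr /dist2 -sqrtrM ?addr_ge0 ?sqr_ge0// ler_wsqrtr//.
(* Cauchy-Schwarz in the plane: by Lagrange's identity the gap between the two sides is the square
   of the cross product. *)
have := sqr_ge0 ((x.1 - y.1) * (y.2 - z.2) - (x.2 - y.2) * (y.1 - z.1)); nra.
Qed.

Lemma ler_abs_dist2 x y : `|x.1 - y.1| <= dist2 x y /\ `|x.2 - y.2| <= dist2 x y.
Proof.
by split; rewrite -(@ler_pXn2r _ 2)// ?nnegrE ?dist2_ge0//
   dist2_sqr real_normK ?num_real// ?lerDl ?lerDr sqr_ge0.
Qed.

Lemma dist2_le_abs x y e : 0 <= e -> `|x.1 - y.1| <= e -> `|x.2 - y.2| <= e ->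
  dist2 x y <= 2 * e.
Proof.
move=> e0; rewrite !ler_norml => /andP[h1 h2] /andP[h3 h4].
rewrite -(@ler_pXn2r _ 2)// ?nnegrE ?dist2_ge0// ?mulr_ge0// dist2_sqr.
nra.
Qed.

Lemma measurable_fun_dist2 d (T : measurableType d) (f g : T -> pt) :
  measurable_fun setT f -> measurable_fun setT g ->
  measurable_fun setT (fun q => dist2 (f q) (g q) : R).
Proof.
move=> mf mg; apply: (measurableT_comp (f := fun xy : pt * pt => dist2 xy.1 xy.2)
  (g := fun q => (f q, g q))); first exact: measurable_dist2.
exact/measurable_fun_pair.
Qed.

Lemma measurable_disc u r : measurable (disc u r : set pt).
Proof.
rewrite /disc -[X in measurable X]setTI.
apply: (measurable_fun_le measurableT) => //.
exact: (measurableT_comp (@measurable_dist2 R) (pair1_measurable u)).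
Qed.

Lemma measurable_circle u r : measurable [set z : pt | dist2 u z = r].
Proof.
have -> : [set z : pt | dist2 u z = r] = disc u r `&` [set z : pt | r <= dist2 u z].
  apply/seteqP; split => z /=; first by move=> <-; rewrite /disc/=; split => /=.
  by move=> [h1 h2]; apply/eqP; rewrite eq_le h1 h2.
apply: measurableI; first exact: measurable_disc.
rewrite -[X in measurable X]setTI; apply: (measurable_fun_le measurableT) => //.
exact: (measurableT_comp (@measurable_dist2 R) (pair1_measurable u)).
Qed.

Definition box (u : pt) (r : R) : set pt :=
  [set` `[u.1 - r, u.1 + r]%R] `*` [set` `[u.2 - r, u.2 + r]%R].

Lemma measurable_box u r : measurable (box u r).
Proof. by apply: measurableX; exact: measurable_itv. Qed.

Lemma disc_sub_box u r : disc u r `<=` box u r.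
Proof.
move=> z /= uz; have [h1 h2] := ler_abs_dist2 u z.
move: (le_trans h1 uz) (le_trans h2 uz).
by rewrite !ler_norml /box/= !in_itv/= => /andP[? ?] /andP[? ?]; split; lra.
Qed.

Lemma leb2_box_lty u r : (leb2 (box u r) < +oo)%E.
Proof.
rewrite leb2X; [|exact: measurable_itv..].
by rewrite !lebesgue_measure_itv/= !lte_fin; case: ifP => _; case: ifP => _;
  rewrite ?mule0 ?mul0e ?ltry// -EFinM ltry.
Qed.

Lemma leb2_sub_lty (A B : set pt) : measurable A -> measurable B -> A `<=` B ->
  (leb2 B < +oo -> leb2 A < +oo)%E.
Proof.
move=> mA mB AB; apply: le_lt_trans.
by apply: le_measure; rewrite ?inE.
Qed.

Lemma leb2_disc_lty u r : (leb2 (disc u r) < +oo)%E.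
Proof.
apply: (leb2_sub_lty (measurable_disc _ _) (measurable_box u r)).
  exact: disc_sub_box.
exact: leb2_box_lty.
Qed.

Lemma leb2_discU_lty u r v s : (leb2 (disc u r `|` disc v s) < +oo)%E.
Proof.
apply: (@le_lt_trans _ _ (leb2 (disc u r) + leb2 (disc v s))%E).
  by apply: measureU2; exact: measurable_disc.
by rewrite lte_add_pinfty ?leb2_disc_lty.
Qed.

(** Each vertical section has at most two points, so the iterated integral vanishes. *)
Lemma leb2_circle u r : leb2 [set z : pt | dist2 u z = r] = 0%E.
Proof.
rewrite /leb2 /product_measure1; apply: integral0_eq => a _ /=.
apply: countable_lebesgue_measure0; apply: finite_set_countable.
(* When the radicand is negative the section is empty, and the default value zero of the root does
   no harm. *)
pose c := Num.sqrt (r ^+ 2 - (u.1 - a) ^+ 2).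
apply: (@sub_finite_set _ _ [set u.2 + c; u.2 - c]); last exact: finite_set2.
move=> b; rewrite /xsection/= inE/= => ub.
have h : (u.2 - b) ^+ 2 = r ^+ 2 - (u.1 - a) ^+ 2.
  by rewrite -ub dist2_sqr/=; ring.
have : `|u.2 - b| = c by rewrite /c -h sqrtr_sqr.
by case: (ger0P (u.2 - b)) => _ <-; [right|left]; ring.
Qed.

Lemma near_inftyS (Q : nat -> Prop) N :
  (\forall n \near \oo, Q n) -> \forall n \near \oo, Q (n + N)%N.
Proof.
by move=> [M _ h]; exists M => // n /= Mn; apply: h => /=; exact: leq_trans (leq_addr _ _).
Qed.

(** Off the limit circle, distance minus radius has a nonzero limit, so its sign is eventually
    constant. *)
Lemma near_disc_mem (u : nat -> pt) (r : nat -> R) u0 r0 z :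
  dist2 (u n) u0 @[n --> \oo] --> 0 -> r n @[n --> \oo] --> r0 ->
  dist2 u0 z != r0 ->
  \forall n \near \oo, (z \in disc (u n) (r n)) = (z \in disc u0 r0).
Proof.
move=> uu0 rr0 zr.
have h : (dist2 (u n) z - r n) @[n --> \oo] --> dist2 u0 z - r0.
  apply: cvgB => //.
  apply: (@squeeze_cvgr _ _ _ _ (fun n => dist2 u0 z - dist2 (u n) u0)
                                 (fun n => dist2 u0 z + dist2 (u n) u0)).
  - near=> n; have := dist2_triangle (u n) u0 z; have := dist2_triangle u0 (u n) z.
    rewrite (dist2C u0 (u n)) => h1 h2; apply/andP; split; lra.
  - rewrite -[X in _ --> X]subr0; apply: cvgB => //; exact: cvg_cst.
  - rewrite -[X in _ --> X]addr0; apply: cvgD => //; exact: cvg_cst.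
have [lt0|gt0|/eqP] := ltrgtP (dist2 u0 z - r0) 0; last by rewrite subr_eq0 (negbTE zr).
- have near1 : \forall t \near \oo, dist2 (u t) z - r t < 0 by exact: (cvgr_lt _ h).
  near=> n; have : dist2 (u n) z - r n < 0 by near: n.
  move=> h1; apply/idP/idP; rewrite !inE /disc/= => _; lra.
- have near1 : \forall t \near \oo, 0 < dist2 (u t) z - r t by exact: (cvgr_gt _ h).
  near=> n; have : 0 < dist2 (u n) z - r n by near: n.
  move=> h1; apply/idP/idP; rewrite !inE /disc/= => ?; lra.
Unshelve. all: by end_near. Qed.

(* The indicators converge off the two limit circles, which are null. *)
Lemma cvg_area_discU (u v : nat -> pt) (r s : nat -> R) (u0 v0 : pt) (r0 s0 : R) :
  dist2 (u n) u0 @[n --> \oo] --> 0 -> dist2 (v n) v0 @[n --> \oo] --> 0 ->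
  r n @[n --> \oo] --> r0 -> s n @[n --> \oo] --> s0 ->
  fine (leb2 (disc (u n) (r n) `|` disc (v n) (s n))) @[n --> \oo] -->
  fine (leb2 (disc u0 r0 `|` disc v0 s0)).
Proof.
move=> uu0 vv0 rr0 ss0.
have [N _ hN] : \forall n \near \oo, dist2 (u n) u0 <= 1 /\ dist2 (v n) v0 <= 1 /\
    r n <= r0 + 1 /\ s n <= s0 + 1.
  near=> n; split; [|split; [|split]]; apply/ltW; near: n.
  - exact: (cvgr_lt _ uu0).
  - exact: (cvgr_lt _ vv0).
  - by apply: (cvgr_lt _ rr0); rewrite ltrDl.
  - by apply: (cvgr_lt _ ss0); rewrite ltrDl.
pose A n := disc (u n) (r n) `|` disc (v n) (s n).
pose A0 := disc u0 r0 `|` disc v0 s0.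
(* Centres are off by at most 1 and radii exceed their limits by at most 1, whence the margin 2. *)
pose B := disc u0 (r0 + 2) `|` disc v0 (s0 + 2).
have mA n : measurable (A n : set pt) by apply: measurableU; exact: measurable_disc.
have mA0 : measurable (A0 : set pt) by apply: measurableU; exact: measurable_disc.
have mB : measurable (B : set pt) by apply: measurableU; exact: measurable_disc.
(* The domination by the indicator of [B] is known from [N] on only, so the sequence is shifted. *)
rewrite -(cvg_shiftn N).
apply: fine_cvg; rewrite fineK; last first.
  by rewrite ge0_fin_numE ?leb2_discU_lty.
have E (C : set pt) : measurable C -> leb2 C = (\int[@leb2 R]_z (\1_C z)%:E)%E.
  by move=> mC; rewrite integral_indic// setIT.
have mI (C : set pt) : measurable C ->
    measurable_fun setT (fun z : pt => (\1_C z : R)%:E).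
  by move=> mC; apply/measurable_EFinP; exact: measurable_indic.
have [|||||_ _ +] := @dominated_convergence _ pt R (@leb2 R) setT measurableT
  (fun n z => (\1_(A (n + N)%N) z)%:E) (fun z => (\1_A0 z)%:E)
  (fun z => (\1_B z)%:E).
- by move=> n; exact: mI.
- exact: mI.
- exists ([set z : pt | dist2 u0 z = r0] `|` [set z : pt | dist2 v0 z = s0]).
  split; first by apply: measurableU; exact: measurable_circle.
    have mC c t := @measurable_circle c t.
    exact: (etrans (measureU0 (mC _ _) (mC _ _) (leb2_circle v0 s0)) (leb2_circle u0 r0)).
  move=> z /=; apply: contra_notP => /not_orP[/eqP zu /eqP zv] _.
  apply: cvg_near_cst; near=> n; congr (_%:E).
  rewrite !indicE !in_setU; congr ((_ || _)%:R); near: n.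
  + exact: (near_inftyS N (near_disc_mem uu0 rr0 zu)).
  + exact: (near_inftyS N (near_disc_mem vv0 ss0 zv)).
- apply/integrableP; split; first exact: mI.
  rewrite (eq_integral (fun z => (\1_B z)%:E)); last first.
    by move=> z _; rewrite gee0_abs// lee_fin.
  by rewrite -E// leb2_discU_lty.
- apply: aeW => z n _; rewrite gee0_abs ?lee_fin// !indicE.
  have [zA|] := boolP (z \in A _) => //.
  suff -> : z \in B by [].
  have [h1 [h2 [h3 h4]]] := hN (n + N)%N (leq_addl _ _).
  move: zA; rewrite !inE => -[] /= zz; [left|right] => /=.
  + move: zz; rewrite /disc/=; have := dist2_triangle (u (n + N)%N) u0 z; rewrite (dist2C u0 (u _)); lra.
  + move: zz; rewrite /disc/=; have := dist2_triangle (v (n + N)%N) v0 z; rewrite (dist2C v0 (v _)); lra.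
- rewrite -E//; have -> // : [sequence (\int[@leb2 R]_z (\1_(A (n + N)%N) z)%:E)%E]_n =
    (fun n => leb2 (A (n + N)%N)).
  by apply/funext => n; rewrite [RHS]E.
Unshelve. all: by end_near. Qed.

(** The area is the measure of a section of one measurable set, with the two users as parameters. *)
Lemma measurable_union_area (a : R) :
  measurable_fun setT (fun xy : pt * pt => union_area a xy.1 xy.2).
Proof.
pose A := [set q : (pt * pt) * pt | dist2 q.1.1 q.2 <= a * normpt q.1.1] `|`
          [set q : (pt * pt) * pt | dist2 q.1.2 q.2 <= a * normpt q.1.2].
have mA : measurable A.
  apply: measurableU; rewrite -[X in measurable X]setTI;
    apply: (measurable_fun_le measurableT).
  - apply: measurable_fun_dist2; last exact: measurable_snd.
    by apply: measurableT_comp; exact: measurable_fst.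
  - apply: measurable_funM => //; apply: measurable_fun_dist2 => //.
    by apply: measurableT_comp; exact: measurable_fst.
  - apply: measurable_fun_dist2; last exact: measurable_snd.
    by apply: measurableT_comp; [exact: measurable_snd|exact: measurable_fst].
  - apply: measurable_funM => //; apply: measurable_fun_dist2 => //.
    by apply: measurableT_comp; [exact: measurable_snd|exact: measurable_fst].
apply: (eq_measurable_fun (fun xy => fine ((@leb2 R \o xsection A) xy))).
  move=> -[x y] _; rewrite /union_area/=; congr (fine (leb2 _)).
  by apply/seteqP; split => z; rewrite /xsection/= inE.
apply: measurableT_comp; first exact: fine_measurable.
exact: (@measurable_fun_xsection _ _ _ _ R (@leb2 R) A mA).
Qed.

End plane.

(** * Square meshes *)

Section mesh.
Variable R : realType.
Local Notation pt := (R1 R * R1 R)%type.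
Implicit Types (K n : nat).

Definition mesh n : R := n.+1%:R^-1.

Lemma mesh_gt0 n : 0 < mesh n. Proof. by rewrite invr_gt0. Qed.

Lemma mesh_natV n : n.+1%:R * mesh n = 1.
Proof. by rewrite mulfV// pnatr_eq0. Qed.

Lemma cvg_mesh : mesh n @[n --> \oo] --> (0 : R).
Proof. exact: cvg_harmonic. Qed.

Definition grid K n (i : nat) : R := - K%:R + i%:R * mesh n.

Definition strip K n (i : nat) : set R := [set` `[grid K n i, grid K n i.+1[%R].

(** After rescaling, the strip index of [x] is the integer part of $(x+K)(n+1)$; uniqueness and
    existence of the strip come from those of the integer part. *)
Lemma stripP K n i x :
  strip K n i x <-> i%:R <= (x + K%:R) * n.+1%:R < i.+1%:R.
Proof.
rewrite /strip/= in_itv/= /grid.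
have m := mesh_gt0 n; have e := mesh_natV n.
have p : 0 < n.+1%:R :> R by rewrite ltr0n.
have E (j : nat) : (- K%:R + j%:R * mesh n <= x) = (j%:R <= (x + K%:R) * n.+1%:R).
  by rewrite addrC lerBlDr /mesh ler_pdivrMr.
by rewrite E [X in _ && X]ltNge E -ltNge; split.
Qed.

Lemma strip_inj K n i j x : strip K n i x -> strip K n j x -> i = j.
Proof.
move=> /stripP/andP[h1 h2] /stripP/andP[h3 h4].
have := le_lt_trans h1 h4; have := le_lt_trans h3 h2.
by rewrite !ltr_nat !ltnS => a b; apply/eqP; rewrite eqn_leq a b.
Qed.

Definition cells K n := ('I_(2 * K * n.+1) * 'I_(2 * K * n.+1))%type.

Definition cell K n (c : cells K n) : set pt := strip K n c.1 `*` strip K n c.2.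

Definition corner K n (c : cells K n) : pt := (grid K n c.1, grid K n c.2).

Definition window K : set pt :=
  [set` `[- K%:R, K%:R[%R] `*` [set` `[- K%:R, K%:R[%R].

Lemma measurable_window K : measurable (window K).
Proof. by apply: measurableX; exact: measurable_itv. Qed.

Lemma leb2_window K : leb2 (window K) = ((2 * K%:R) ^+ 2)%:E.
Proof.
rewrite leb2X; [|exact: measurable_itv..].
rewrite !lebesgue_measure_itv/= !lte_fin; case: ifPn => h.
  by rewrite -EFinM; congr (_%:E); ring.
rewrite mule0; have -> : K%:R = 0 :> R; last by rewrite mulr0 expr0n.
by apply/eqP; rewrite -leNgt in h; rewrite eq_le ler0n andbT; lra.
Qed.

Lemma measurable_cell K n (c : cells K n) : measurable (cell c).
Proof. by apply: measurableX; exact: measurable_itv. Qed.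

Lemma leb2_cell K n (c : cells K n) : leb2 (cell c) = (mesh n ^+ 2)%:E.
Proof.
have L i : lebesgue_measure (strip K n i) = (mesh n)%:E.
  rewrite lebesgue_measure_itv/= lte_fin /grid ltrD2l ltr_pM2r ?mesh_gt0// ltr_nat ltnSn.
  by rewrite -EFinB -addn1 natrD; congr (_%:E); ring.
by rewrite leb2X; [rewrite !L -EFinM|exact: measurable_itv..].
Qed.

Lemma cell_inj K n (c c' : cells K n) z : cell c z -> cell c' z -> c = c'.
Proof.
move: c c' => [i j] [i' j'] [/= h1 h2] [/= h3 h4].
by congr (_, _); apply/val_inj; [apply: strip_inj h1 h3|apply: strip_inj h2 h4].
Qed.

Lemma cell_disjoint K n (c c' : cells K n) : c != c' -> cell c `&` cell c' = set0.
Proof.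
by move=> cc'; apply/seteqP; split => // z [h h']; move: cc'; rewrite (cell_inj h h') eqxx.
Qed.

Lemma strip_cover K n x : - K%:R <= x < K%:R ->
  exists i : 'I_(2 * K * n.+1), strip K n i x.
Proof.
move=> /andP[h1 h2]; pose y := (x + K%:R) * n.+1%:R.
have y0 : 0 <= y by rewrite mulr_ge0// -lerBlDr sub0r.
have /andP[t1 t2] := truncn_itv y0.
have lt : (Num.truncn y < 2 * K * n.+1)%N.
  rewrite -(ltr_nat R); apply: (le_lt_trans t1).
  by rewrite /y natrM ltr_pM2r ?ltr0n// natrM; lra.
by exists (Ordinal lt); apply/stripP; rewrite t1 t2.
Qed.

Lemma cell_cover K n z : window K z -> exists c : cells K n, cell c z.
Proof.
move=> [/=]; rewrite !in_itv/= => /(strip_cover n)[i hi] /(strip_cover n)[j hj].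
by exists (i, j).
Qed.

Lemma cell_sub_window K n (c : cells K n) : cell c `<=` window K.
Proof.
have S (i : 'I_(2 * K * n.+1)) x : strip K n i x -> - K%:R <= x < K%:R.
  have p : 0 < n.+1%:R :> R by rewrite ltr0n.
  move=> /stripP/andP[h1 h2]; apply/andP; split.
    by rewrite -subr_ge0 opprK -(pmulr_lge0 _ p); apply: le_trans h1.
  have : (x + K%:R) * n.+1%:R < (2 * K * n.+1)%:R.
    by apply: (lt_le_trans h2); rewrite ler_nat.
  by rewrite natrM ltr_pM2r// natrM; lra.
by move=> z [/S h1 /S h2]; split; rewrite /= in_itv.
Qed.

Lemma dist2_corner K n (c : cells K n) z : cell c z -> dist2 z (corner c) <= 2 * mesh n.
Proof.
move=> [h1 h2]; apply: dist2_le_abs; first exact/ltW/mesh_gt0.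
  move: h1; rewrite /strip/= in_itv/= /grid -natr1 => /andP[h3 h4].
  by rewrite ger0_norm; lra.
move: h2; rewrite /strip/= in_itv/= /grid -natr1 => /andP[h3 h4].
by rewrite ger0_norm; lra.
Qed.

Lemma window_exhaust (z : pt) : exists K, forall K', (K <= K')%N -> window K' z.
Proof.
have [m hm] : exists m, forall K', (m <= K')%N -> `|z.1| + `|z.2| < K'%:R.
  exists (Num.truncn (`|z.1| + `|z.2|)).+1 => K' h.
  apply: lt_le_trans (truncnS_gt _) _; by rewrite ler_nat.
exists m => K' /hm h.
have h1 : `|z.1| < K'%:R by apply: le_lt_trans h; rewrite lerDl.
have h2 : `|z.2| < K'%:R by apply: le_lt_trans h; rewrite lerDr.
by move: h1 h2; rewrite !ltr_norml => /andP[/ltW a b] /andP[/ltW c d]; split; rewrite /= in_itv/= ?a ?b ?c ?d.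
Qed.

Lemma window_le K K' : (K <= K')%N -> window K `<=` window K'.
Proof.
by rewrite -(ler_nat R) => h z []/=; rewrite !in_itv/= => /andP[? ?] /andP[? ?];
  split; rewrite /= in_itv/=; apply/andP; split; lra.
Qed.

End mesh.
Arguments corner {R K n} c.
Arguments cell {R K n} c.
Arguments window {R} K.

(** * Riemann sums over bricks of mesh cells *)

Section riemann.
Variable R : realType.
Local Notation pt := (R1 R * R1 R)%type.
Implicit Types (K n : nat).

Definition area (A : set pt) : R := fine (leb2 A).

Lemma area_ge0 A : 0 <= area A.
Proof. exact/fine_ge0/measure_ge0. Qed.

Lemma areaE A : (leb2 A < +oo)%E -> leb2 A = (area A)%:E.
Proof. by move=> h; rewrite /area fineK// ge0_fin_numE// measure_ge0. Qed.

Definition disc_pair (a s : R) (X u v : pt) : set pt :=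
  disc u (a * dist2 X u + s) `|` disc v (a * dist2 X v + s).

Lemma measurable_disc_pair a s X u v : measurable (disc_pair a s X u v).
Proof. by apply: measurableU; exact: measurable_disc. Qed.

Lemma leb2_disc_pair_lty a s X u v : (leb2 (disc_pair a s X u v) < +oo)%E.
Proof. exact: leb2_discU_lty. Qed.

Definition sub2 (u X : pt) : pt := (u.1 - X.1, u.2 - X.2).

Lemma area_disc_pair0 a X u v :
  area (disc_pair a 0 X u v) = union_area a (sub2 u X) (sub2 v X).
Proof.
rewrite /area /union_area -(invariant_leb2 X (measurable_disc_pair _ _ _ _ _)).
have E1 w z : dist2 w (translate X z) = dist2 (sub2 w X) z.
  by rewrite /dist2/=; congr (Num.sqrt _); ring.
have E2 w : dist2 X w = normpt (sub2 w X).
  by rewrite /normpt /dist2/=; congr (Num.sqrt _); ring.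
congr (fine (leb2 _)); apply/funext => z.
by rewrite /preimage /disc_pair /disc /setU /mkset !E1 !E2 !addr0.
Qed.

Lemma cvg_dist2 (x y : nat -> pt) (x0 y0 : pt) :
  dist2 (x n) x0 @[n --> \oo] --> 0 -> dist2 (y n) y0 @[n --> \oo] --> 0 ->
  dist2 (x n) (y n) @[n --> \oo] --> dist2 x0 y0.
Proof.
move=> hx hy.
apply: (@squeeze_cvgr _ _ _ _ (fun n => dist2 x0 y0 - (dist2 (x n) x0 + dist2 (y n) y0))
                               (fun n => dist2 x0 y0 + (dist2 (x n) x0 + dist2 (y n) y0))).
- near=> n.
  have h1 := dist2_triangle x0 (x n) (y n); have h2 := dist2_triangle y0 x0 (y n).
  have h3 := dist2_triangle (x n) x0 y0; have h4 := dist2_triangle (y n) (x n) y0.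
  rewrite (dist2C y0 (y n)) in h2; rewrite (dist2C x0 (x n)) in h3.
  by apply/andP; split; lra.
- rewrite -[X in _ --> X]subr0 -[X in _ - X]addr0.
  by apply: cvgB; [exact: cvg_cst|exact: cvgD].
- rewrite -[X in _ --> X]addr0 -[X in _ + X]addr0.
  by apply: cvgD; [exact: cvg_cst|exact: cvgD].
Unshelve. all: by end_near. Qed.

Lemma cvg_area_disc_pair a (s : nat -> R) (X u v : nat -> pt) (X0 u0 v0 : pt) :
  dist2 (X n) X0 @[n --> \oo] --> 0 -> dist2 (u n) u0 @[n --> \oo] --> 0 ->
  dist2 (v n) v0 @[n --> \oo] --> 0 -> s n @[n --> \oo] --> 0 ->
  area (disc_pair a (s n) (X n) (u n) (v n)) @[n --> \oo] -->
  union_area a (sub2 u0 X0) (sub2 v0 X0).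
Proof.
move=> hX hu hv hs; rewrite -area_disc_pair0.
apply: cvg_area_discU => //.
  by apply: cvgD => //; apply: cvgM; [exact: cvg_cst|exact: cvg_dist2].
by apply: cvgD => //; apply: cvgM; [exact: cvg_cst|exact: cvg_dist2].
Qed.

Lemma measurable_unit_square : measurable (@unit_square R : set pt).
Proof.
have -> : @unit_square R = [set` `[0, 1]%R] `*` [set` `[0, 1]%R].
  by apply/seteqP; split => z; rewrite /unit_square /setX /= !in_itv.
by apply: measurableX; exact: measurable_itv.
Qed.

Lemma leb2_unit_square : leb2 (@unit_square R) = 1%E.
Proof.
have -> : @unit_square R = [set` `[0, 1]%R] `*` [set` `[0, 1]%R].
  by apply/seteqP; split => z; rewrite /unit_square /setX /= !in_itv.
rewrite leb2X; [|exact: measurable_itv..].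
by rewrite !lebesgue_measure_itv/= lte_fin ltr01 oppr0 adde0 mule1.
Qed.

Local Notation Sq := (@unit_square R).

Definition triples K n := (cells K n * (cells K n * cells K n))%type.

(** Only the first user is cut with the unit square, since the window in the Palm formula constrains
    that user alone. *)
Definition brick K n (t : triples K n) : set (pt * (pt * pt)) :=
  cell t.1 `*` ((cell t.2.1 `&` Sq) `*` cell t.2.2).

Definition bricks K : set (pt * (pt * pt)) :=
  @window R K `*` ((@window R K `&` Sq) `*` @window R K).

Lemma measurable_brick K n (t : triples K n) : measurable (brick t).
Proof.
apply: measurableX; first exact: measurable_cell.
apply: measurableX; last exact: measurable_cell.
by apply: measurableI; [exact: measurable_cell|exact: measurable_unit_square].
Qed.

Lemma measurable_bricks K : measurable (bricks K).
Proof.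
have mW := @measurable_window R K.
apply: measurableX => //; apply: measurableX => //.
by apply: measurableI => //; exact: measurable_unit_square.
Qed.

Lemma brick_sub K n (t : triples K n) : brick t `<=` bricks K.
Proof.
by move=> q [h1 [[h2 h3] h4]]; split; [|split; [split|]] => //;
  [exact: cell_sub_window h1|exact: cell_sub_window h2|exact: cell_sub_window h4].
Qed.

Lemma brick_inj K n (t t' : triples K n) q : brick t q -> brick t' q -> t = t'.
Proof.
move: t t' => [a [b c]] [a' [b' c']] [/= h1 [[h2 _] h3]] [/= k1 [[k2 _] k3]].
by rewrite (cell_inj h1 k1) (cell_inj h2 k2) (cell_inj h3 k3).
Qed.

Lemma brick_cover K n q : bricks K q -> exists t : triples K n, brick t q.
Proof.
move=> [/(cell_cover n)[a ha] [[/(cell_cover n)[b hb] hs] /(cell_cover n)[c hc]]].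
by exists (a, (b, c)).
Qed.

Definition brick_area K n (t : triples K n) : R :=
  area (cell t.1) * (area (cell t.2.1 `&` Sq) * area (cell t.2.2)).

Lemma leb2_cellI_lty K n (c : cells K n) : (leb2 (cell c `&` Sq) < +oo)%E.
Proof.
apply: (@le_lt_trans _ _ (leb2 (cell c))); last by rewrite leb2_cell ltry.
apply: le_measure; rewrite ?inE; last exact: subIsetl.
  by apply: measurableI; [exact: measurable_cell|exact: measurable_unit_square].
exact: measurable_cell.
Qed.

Lemma leb6_brick K n (t : triples K n) : leb6 (brick t) = (brick_area t)%:E.
Proof.
have mc (c : cells K n) := @measurable_cell R K n c.
have mS (c : cells K n) : measurable (cell c `&` Sq).
  by apply: measurableI => //; exact: measurable_unit_square.
rewrite leb6X//; last exact: measurableX.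
rewrite leb4X// /brick_area !EFinM.
have h (c : cells K n) : (leb2 (cell c : set pt) < +oo)%E by rewrite leb2_cell ltry.
by rewrite (areaE (h t.1)) (areaE (h t.2.2)) (areaE (leb2_cellI_lty t.2.1)).
Qed.

Definition step_fun K n (g : triples K n -> R) (q : pt * (pt * pt)) : R :=
  \sum_t g t * \1_(brick t) q.

Lemma step_funE K n (g : triples K n -> R) t q : brick t q -> step_fun g q = g t.
Proof.
move=> tq; rewrite /step_fun (bigD1 t)//= big1 ?addr0.
  by rewrite indicE mem_set// mulr1.
move=> t' /eqP tt'; rewrite indicE memNset ?mulr0// => t'q.
by apply: tt'; exact: brick_inj t'q tq.
Qed.

Lemma step_fun0 K n (g : triples K n -> R) q : ~ bricks K q -> step_fun g q = 0.
Proof.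
move=> nq; rewrite /step_fun big1// => t _; rewrite indicE memNset ?mulr0// => /brick_sub.
exact: nq.
Qed.

Lemma measurable_step_fun K n (g : triples K n -> R) : measurable_fun setT (step_fun g).
Proof.
apply: measurable_sum => t; apply: measurable_funM => //.
by apply: measurable_indic; exact: measurable_brick.
Qed.

Lemma integral_step_fun K n (g : triples K n -> R) : (forall t, 0 <= g t) ->
  (\int[@leb6 R]_q (step_fun g q)%:E = (\sum_t g t * brick_area t)%:E)%E.
Proof.
move=> g0; have mI t : measurable_fun setT
    (fun q => (\1_(@brick K n t) q : R)%:E).
  by apply/measurable_EFinP; apply: measurable_indic; exact: measurable_brick.
under eq_integral do rewrite /step_fun -sumEFin.
rewrite ge0_integral_sum//; last 2 first.
  - move=> t; apply/measurable_EFinP; apply: measurable_funM => //.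
    by apply: measurable_indic; exact: measurable_brick.
  - by move=> t q _; rewrite lee_fin mulr_ge0.
rewrite -sumEFin; apply: eq_bigr => t _.
under eq_integral do rewrite EFinM.
rewrite ge0_integralZl_EFin//.
rewrite integral_indic//; last exact: measurable_brick.
by rewrite setIT [X in (_ * X)%E]leb6_brick -EFinM.
Qed.

(** The probability that a station at the origin serves users at $x$ and $y$: a product of void
    probabilities, with [l1] for the tier of that station and [l2], at radius ratio [a], for the
    other tier. *)
Definition contact (l1 l2 a : R) (xy : pt * pt) : R :=
  expR (- l1 * union_area 1 xy.1 xy.2) * expR (- l2 * union_area a xy.1 xy.2).

Lemma measurable_contact l1 l2 a : measurable_fun setT (contact l1 l2 a).
Proof.
apply: measurable_funM; apply: measurableT_comp => //; apply: measurable_funM => //;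
  exact: measurable_union_area.
Qed.

Definition contact3 (l1 l2 a : R) (q : pt * (pt * pt)) : R :=
  contact l1 l2 a (sub2 q.2.1 q.1, sub2 q.2.2 q.1).

Lemma measurable_contact3 l1 l2 a : measurable_fun setT (contact3 l1 l2 a).
Proof.
have f1 : measurable_fun setT (fun q : pt * (pt * pt) => q.2.1.1 : R)
  by exact: (measurableT_comp measurable_fst (measurableT_comp measurable_fst measurable_snd)).
have f2 : measurable_fun setT (fun q : pt * (pt * pt) => q.2.1.2 : R)
  by exact: (measurableT_comp measurable_snd (measurableT_comp measurable_fst measurable_snd)).
have f3 : measurable_fun setT (fun q : pt * (pt * pt) => q.2.2.1 : R)
  by exact: (measurableT_comp measurable_fst (measurableT_comp measurable_snd measurable_snd)).
have f4 : measurable_fun setT (fun q : pt * (pt * pt) => q.2.2.2 : R)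
  by exact: (measurableT_comp measurable_snd (measurableT_comp measurable_snd measurable_snd)).
have f5 : measurable_fun setT (fun q : pt * (pt * pt) => q.1.1 : R) by exact: measurableT_comp.
have f6 : measurable_fun setT (fun q : pt * (pt * pt) => q.1.2 : R) by exact: measurableT_comp.
apply: (measurableT_comp (f := contact l1 l2 a)
  (g := fun q : pt * (pt * pt) => (sub2 q.2.1 q.1, sub2 q.2.2 q.1)));
  first exact: measurable_contact.
by apply/measurable_fun_pair; apply/measurable_fun_pair; exact: measurable_funB.
Qed.

Lemma contact_ge0 l1 l2 a xy : 0 <= contact l1 l2 a xy.
Proof. by rewrite mulr_ge0// expR_ge0. Qed.

Lemma contact_le1 l1 l2 a xy : 0 <= l1 -> 0 <= l2 -> contact l1 l2 a xy <= 1.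
Proof.
move=> h1 h2; rewrite -(mulr1 1) ler_pM// ?expR_ge0// -[leRHS]expR0 ler_expR mulNr oppr_le0
  mulr_ge0//; exact/fine_ge0/measure_ge0.
Qed.

(** The contact factor frozen at the corners of the cells; [s] and [s'] enlarge or shrink the radii,
    according to their sign, to absorb motion inside the cells. *)
Definition contact_cell (l1 l2 a s s' : R) K n (t : triples K n) : R :=
  expR (- l1 * area (disc_pair 1 s (corner t.1) (corner t.2.1) (corner t.2.2))) *
  expR (- l2 * area (disc_pair a s' (corner t.1) (corner t.2.1) (corner t.2.2))).

Lemma contact_cell_ge0 l1 l2 a s s' K n (t : triples K n) :
  0 <= contact_cell l1 l2 a s s' t.
Proof. by rewrite mulr_ge0// expR_ge0. Qed.

Lemma contact_cell_le1 l1 l2 a s s' K n (t : triples K n) : 0 <= l1 -> 0 <= l2 ->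
  contact_cell l1 l2 a s s' t <= 1.
Proof.
move=> h1 h2; rewrite -(mulr1 1) ler_pM// ?expR_ge0// -[leRHS]expR0 ler_expR mulNr oppr_le0
  mulr_ge0//; exact: area_ge0.
Qed.

End riemann.
Arguments contact_cell {R} l1 l2 a s s' {K n} t.
Arguments brick_area {R K n} t.

(** * Limits of the Riemann sums *)

Section limits.
Variable R : realType.
Local Notation pt := (R1 R * R1 R)%type.
Local Notation Sq := (@unit_square R).
Implicit Types (K n : nat).

Lemma leb2_set1 (x : pt) : leb2 [set x] = 0%E.
Proof.
have -> : [set x] = [set z : pt | dist2 x z = 0].
  by apply/seteqP; split => z /=; [move=> ->; exact: dist2xx|move/dist2_eq0].
exact: leb2_circle.
Qed.

Lemma measurable_coincidence d (T : measurableType d) (f g : T -> pt) :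
  measurable_fun setT f -> measurable_fun setT g -> measurable [set q | f q = g q].
Proof.
move=> mf mg.
have -> : [set q | f q = g q] = setT `&` [set q | dist2 (f q) (g q) <= 0].
  rewrite setTI; apply/seteqP; split => q /=; first by move=> ->; rewrite dist2xx.
  by move=> h; apply: dist2_eq0; apply/eqP; rewrite eq_le h dist2_ge0.
by apply: measurable_fun_le => //; exact: measurable_fun_dist2.
Qed.

(** Off this set, the three points lie in distinct cells of every sufficiently fine mesh. *)
Definition coincidences : set (pt * (pt * pt)) :=
  [set q | q.1 = q.2.1] `|` [set q | q.1 = q.2.2] `|` [set q | q.2.1 = q.2.2].

(** In each of the three cases, fixing one of the two coinciding points confines the other to a
    single point, which is null. *)
Lemma leb6_coincidences :
  measurable coincidences /\ leb6 coincidences = 0%E.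
Proof.
have m21 : measurable_fun setT (fun q : pt * (pt * pt) => q.2.1).
  exact: (measurableT_comp measurable_fst measurable_snd).
have m22 : measurable_fun setT (fun q : pt * (pt * pt) => q.2.2).
  exact: (measurableT_comp measurable_snd measurable_snd).
have m1 : measurable_fun setT (fun q : pt * (pt * pt) => q.1) by exact: measurable_fst.
have mA := measurable_coincidence m1 m21.
have mB := measurable_coincidence m1 m22.
have mC := measurable_coincidence m21 m22.
have m01 (x : pt) : measurable ([set x] : set pt).
  have -> : [set x] = [set z : pt | dist2 x z = 0].
    by apply/seteqP; split => z /=; [move=> ->; exact: dist2xx|move/dist2_eq0].
  exact: measurable_circle.
have A0 : leb6 [set q : pt * (pt * pt) | q.1 = q.2.1] = 0%E.
  rewrite /leb6 /prodm /product_measure1; apply: integral0_eq => x _ /=.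
  have -> : xsection [set q : pt * (pt * pt) | q.1 = q.2.1] x = [set x] `*` setT.
    by apply/seteqP; split => p; rewrite /xsection /= ?inE/= ?inE => // -[->].
  by rewrite leb4X// leb2_set1 mul0e.
have B0 : leb6 [set q : pt * (pt * pt) | q.1 = q.2.2] = 0%E.
  rewrite /leb6 /prodm /product_measure1; apply: integral0_eq => x _ /=.
  have -> : xsection [set q : pt * (pt * pt) | q.1 = q.2.2] x = setT `*` [set x].
    by apply/seteqP; split => p; rewrite /xsection /= ?inE/= ?inE => // -[_ ->].
  by rewrite leb4X// leb2_set1 mule0.
have C0 : leb6 [set q : pt * (pt * pt) | q.2.1 = q.2.2] = 0%E.
  rewrite /leb6 /prodm /product_measure1; apply: integral0_eq => x _ /=.
  have -> : xsection [set q : pt * (pt * pt) | q.2.1 = q.2.2] x = [set p | p.1 = p.2].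
    by apply/seteqP; split => p; rewrite /xsection /= ?inE/= ?inE.
  rewrite /leb4 /product_measure1; apply: integral0_eq => y _ /=.
  have -> : xsection [set p : pt * pt | p.1 = p.2] y = [set y].
    by apply/seteqP; split => p; rewrite /xsection /= ?inE/= ?inE.
  exact: leb2_set1.
split; first by apply: measurableU => //; exact: measurableU.
have AB := etrans (measureU0 mA mB B0) A0.
exact: (etrans (measureU0 (measurableU _ _ mA mB) mC C0) AB).
Qed.

Lemma leb6_bricks_lty K : (leb6 (@bricks R K) < +oo)%E.
Proof.
have mW := @measurable_window R K.
have mWS : measurable (window K `&` Sq).
  by apply: measurableI => //; exact: measurable_unit_square.
have fW : (leb2 (window K : set pt) < +oo)%E by rewrite leb2_window ltry.
have fWS : (leb2 (window K `&` Sq) < +oo)%E.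
  by apply: (leb2_sub_lty mWS mW _ fW); exact: subIsetl.
rewrite leb6X//; last exact: measurableX.
by rewrite leb4X// (areaE fW) (areaE fWS) -!EFinM ltry.
Qed.

Definition masked (T : Type) (b : T -> bool) (g : T -> R) (t : T) : R :=
  if b t then g t else 0.

(** Dominated convergence: the step functions are at most the indicator of [bricks K], and off the
    coincidences the brick around [q] shrinks to [q] while the slacks vanish. The mask is eventually
    true at each such [q], so it disappears in the limit. *)
Lemma cvg_integral_step K (l1 l2 a : R) (s s' : nat -> R)
    (b : forall n, triples K n -> bool) :
  0 <= l1 -> 0 <= l2 -> s n @[n --> \oo] --> 0 -> s' n @[n --> \oo] --> 0 ->
  (forall q, ~ coincidences q ->
    \forall n \near \oo, forall t : triples K n, brick t q -> b n t) ->
  (\int[@leb6 R]_q (step_fun (masked (b n) (contact_cell l1 l2 a (s n) (s' n))) q)%:E)%E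
    @[n --> \oo] -->
  (\int[@leb6 R]_q (\1_(bricks K) q * contact3 l1 l2 a q)%:E)%E.
Proof.
move=> l10 l20 hs hs' hb.
have mk0 n t : 0 <= masked (b n) (contact_cell l1 l2 a (s n) (s' n)) t.
  by rewrite /masked; case: ifP => // _; exact: contact_cell_ge0.
have mk1 n t : masked (b n) (contact_cell l1 l2 a (s n) (s' n)) t <= 1.
  by rewrite /masked; case: ifP => // _; exact: contact_cell_le1.
have [mN N0] := leb6_coincidences.
have mBr : measurable_fun setT (\1_(bricks K) : pt * (pt * pt) -> R).
  by apply: measurable_indic; exact: measurable_bricks.
have [|||||_ _ +] := @dominated_convergence _ (pt * (pt * pt))%type R (@leb6 R)
  setT measurableT
  (fun n q => (step_fun (masked (b n) (contact_cell l1 l2 a (s n) (s' n))) q)%:E)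
  (fun q => (\1_(bricks K) q * contact3 l1 l2 a q)%:E) (fun q => (\1_(bricks K) q)%:E).
- by move=> n; apply/measurable_EFinP; exact: measurable_step_fun.
- apply/measurable_EFinP; apply: measurable_funM => //; exact: measurable_contact3.
- exists coincidences; split => //.
  move=> q /=; apply: contra_notP => nq _.
  apply: cvg_EFin; first by apply: nearW.
  have [qB|qB] := pselect (bricks K q); last first.
    rewrite indicE memNset// mul0r; apply: cvg_near_cst; near=> n.
    by rewrite /= step_fun0.
  rewrite indicE mem_set// mul1r.
  pose t n := sval (cid (brick_cover n qB)).
  have ht n : brick (t n) q := svalP (cid (brick_cover n qB)).
  have c0 (x : pt) (c : forall n, cells K n) : (forall n, cell (c n) x) ->
      dist2 (corner (c n)) x @[n --> \oo] --> 0.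
    move=> hc; apply: (@squeeze_cvgr _ _ _ _ (fun=> 0) (fun n => 2 * mesh R n)).
    + by apply: nearW => n; rewrite dist2_ge0 dist2C dist2_corner.
    + exact: cvg_cst.
    + by rewrite -[X in _ --> X](mulr0 2); apply: cvgM; [exact: cvg_cst|exact: cvg_mesh].
  have h1 := c0 q.1 (fun n => (t n).1) (fun n => (ht n).1).
  have h2 := c0 q.2.1 (fun n => (t n).2.1) (fun n => (ht n).2.1.1).
  have h3 := c0 q.2.2 (fun n => (t n).2.2) (fun n => (ht n).2.2).
  have L : contact_cell l1 l2 a (s n) (s' n) (t n) @[n --> \oo] --> contact3 l1 l2 a q.
    apply: cvgM; apply: (continuous_cvg _ (@continuous_expR R _)); apply: cvgM;
      [exact: cvg_cst|exact: cvg_area_disc_pair|exact: cvg_cst|exact: cvg_area_disc_pair].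
  apply: cvg_trans L; apply: near_eq_cvg; near=> n.
  rewrite /= (step_funE _ (ht n)) /masked.
  have -> : b n (t n) by move: (ht n); near: n; apply: filterS (hb q nq) => n; exact.
  by [].
- apply/integrableP; split; first exact/measurable_EFinP.
  rewrite (eq_integral (fun q => (\1_(bricks K) q)%:E)); last first.
    by move=> z _; rewrite gee0_abs// lee_fin.
  rewrite integral_indic ?setIT//; last exact: measurable_bricks.
  exact: leb6_bricks_lty.
- apply: aeW => q n _; rewrite gee0_abs; last first.
    by rewrite lee_fin sumr_ge0// => t _; rewrite mulr_ge0.
  rewrite lee_fin indicE; have [qB|qB] := boolP (q \in bricks K); last first.
    by rewrite notin_setE in qB; rewrite step_fun0.
  by have [t tq] := brick_cover n (set_mem qB); rewrite (step_funE _ tq).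
- exact.
Unshelve. all: by end_near. Qed.

Definition contact_integral l1 l2 a : \bar R :=
  (\int[@leb4 R]_xy (contact l1 l2 a xy)%:E)%E.

(** Translating both users by the station frees the contact factor of the station's position. What
    remains of that position is the indicator of a translated unit square, whose integral is 1. *)
Lemma integral_contact3 l1 l2 a :
  (\int[@leb6 R]_q (\1_Sq q.2.1 * contact3 l1 l2 a q)%:E)%E = contact_integral l1 l2 a.
Proof.
have mSq : measurable_fun setT (\1_Sq : pt -> R).
  by apply: measurable_indic; exact: measurable_unit_square.
have m21 : measurable_fun setT (fun q : pt * (pt * pt) => q.2.1).
  exact: (measurableT_comp measurable_fst measurable_snd).
have mC := measurable_contact l1 l2 a.
rewrite (fubini_tonelli1 (m1 := @leb2 R) (m2 := @leb4 R)); last 2 first.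
- apply/measurable_EFinP; apply: measurable_funM; last exact: measurable_contact3.
  exact: (measurableT_comp mSq m21).
- by move=> q; rewrite lee_fin mulr_ge0// contact_ge0.
have mtr : measurable_fun setT (fun q : pt * (pt * pt) => translate q.1 q.2.1).
  have f1 : measurable_fun setT (fun q : pt * (pt * pt) => q.2.1.1 : R).
    exact: (measurableT_comp measurable_fst m21).
  have f2 : measurable_fun setT (fun q : pt * (pt * pt) => q.2.1.2 : R).
    exact: (measurableT_comp measurable_snd m21).
  have f3 : measurable_fun setT (fun q : pt * (pt * pt) => q.1.1 : R).
    exact: measurableT_comp.
  have f4 : measurable_fun setT (fun q : pt * (pt * pt) => q.1.2 : R).
    exact: measurableT_comp.
  by apply/measurable_fun_pair; exact: measurable_funD.
transitivity (\int[@leb2 R]_X \int[@leb4 R]_p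
    (\1_Sq (translate X p.1) * contact l1 l2 a p)%:E)%E.
  apply: eq_integral => X _; rewrite /fubini_F.
  pose F (p : pt * pt) := (\1_Sq p.1 * contact3 l1 l2 a (X, p))%:E.
  have mF : measurable_fun setT F.
    apply/measurable_EFinP; apply: measurable_funM.
      exact: (measurableT_comp mSq measurable_fst).
    exact: (measurableT_comp (measurable_contact3 l1 l2 a) (pair1_measurable X)).
  have F0 p : (0 <= F p)%E by rewrite lee_fin mulr_ge0// contact_ge0.
  have mphi : measurable_fun setT (fun p : pt * pt => (translate X p.1, translate X p.2)).
    apply/measurable_fun_pair.
      exact: (measurableT_comp (measurable_translate X) measurable_fst).
    exact: (measurableT_comp (measurable_translate X) measurable_snd).
  rewrite -[LHS](invariant_integral mphi (invariant_leb4 X) mF F0) /F.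
  apply: eq_integral => -[[p1 p2] [p3 p4]] _ /=; rewrite /contact3 /sub2 /translate/=.
  by rewrite !addrK.
rewrite (fubini_tonelli (m1 := @leb2 R) (m2 := @leb4 R)
  (fun q => (\1_Sq (translate q.1 q.2.1) * contact l1 l2 a q.2)%:E)); last 2 first.
- apply/measurable_EFinP; apply: measurable_funM.
    exact: (measurableT_comp mSq mtr).
  exact: (measurableT_comp mC measurable_snd).
- by move=> q; rewrite lee_fin mulr_ge0// contact_ge0.
apply: eq_integral => p _ /=.
have E X : translate X p.1 = translate p.1 X.
  by rewrite /translate; congr (_, _); rewrite addrC.
under eq_integral do rewrite E mulrC EFinM.
rewrite ge0_integralZl_EFin//; last 2 first.
- by apply/measurable_EFinP; apply: (measurableT_comp mSq); exact: measurable_translate.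
- exact: contact_ge0.
rewrite (invariant_integral (mu := @leb2 R) (phi := translate p.1) (f := fun x => (\1_Sq x)%:E))//;
  last 3 first.
- exact: measurable_translate.
- exact: invariant_leb2.
- exact/measurable_EFinP.
rewrite integral_indic//; last exact: measurable_unit_square.
by rewrite setIT [X in (_ * X)%E]leb2_unit_square mule1.
Qed.

Definition window_integral K l1 l2 a : \bar R :=
  (\int[@leb6 R]_q (\1_(bricks K) q * contact3 l1 l2 a q)%:E)%E.

Lemma window_integral_le K l1 l2 a :
  (window_integral K l1 l2 a <= contact_integral l1 l2 a)%E.
Proof.
have mSq : measurable_fun setT (\1_Sq : pt -> R).
  by apply: measurable_indic; exact: measurable_unit_square.
have m21 : measurable_fun setT (fun q : pt * (pt * pt) => q.2.1).
  exact: (measurableT_comp measurable_fst measurable_snd).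
rewrite -integral_contact3; apply: ge0_le_integral => //.
- by move=> q _; rewrite lee_fin mulr_ge0// contact_ge0.
- apply/measurable_EFinP; apply: measurable_funM; last exact: measurable_contact3.
  by apply: measurable_indic; exact: measurable_bricks.
- apply/measurable_EFinP; apply: measurable_funM; last exact: measurable_contact3.
  exact: (measurableT_comp mSq m21).
- move=> q _; rewrite lee_fin ler_wpM2r ?contact_ge0// !indicE ler_nat.
  case: (boolP (q \in bricks K)) => //; rewrite inE => -[_ [[_ h] _]].
  by rewrite mem_set.
Qed.

(** As the windows exhaust the plane, the indicators of [bricks K] increase to the condition that
    the first user is in the unit square. *)
Lemma cvg_window_integral l1 l2 a :
  window_integral K l1 l2 a @[K --> \oo] --> contact_integral l1 l2 a.
Proof.
rewrite -integral_contact3.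
pose g K (q : pt * (pt * pt)) := (\1_(bricks K) q * contact3 l1 l2 a q)%:E.
have g0 K q : (0 <= g K q)%E by rewrite lee_fin mulr_ge0// contact_ge0.
have mg K : measurable_fun setT (g K).
  apply/measurable_EFinP; apply: measurable_funM; last exact: measurable_contact3.
  by apply: measurable_indic; exact: measurable_bricks.
have -> : (\int[@leb6 R]_q (\1_Sq q.2.1 * contact3 l1 l2 a q)%:E)%E =
    (\int[@leb6 R]_q limn (g^~ q))%E.
  apply: eq_integral => q _; apply/esym/cvg_lim => //; apply: cvg_near_cst.
  have [K1 h1] := window_exhaust q.1; have [K2 h2] := window_exhaust q.2.1.
  have [K3 h3] := window_exhaust q.2.2.
  exists (K1 + K2 + K3)%N => // K /= hK; rewrite /g; congr ((_ * _)%:E).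
  rewrite !indicE; suff -> : (q \in bricks K) = (q.2.1 \in Sq) by [].
  apply/idP/idP; rewrite !inE; first by case=> _ [[]].
  move=> hS; split; first by apply: h1; lia.
  by split; [split => //; apply: h2; lia|apply: h3; lia].
apply: (cvg_monotone_convergence (mu := @leb6 R) measurableT mg (fun K q _ => g0 K q)).
move=> q _ m n mn; rewrite lee_fin ler_wpM2r ?contact_ge0// !indicE ler_nat.
have [|//] := boolP (q \in bricks m); rewrite inE => -[k1 [[k2 k3] k4]].
rewrite mem_set//; split; first exact: window_le mn _ k1.
by split; [split => //; exact: window_le mn _ k2|exact: window_le mn _ k4].
Qed.

End limits.

(** * Counting points *)

Section counting.
Variable R : realType.

Lemma esum1_sub (T : choiceType) (P Q : set T) : P `<=` Q ->
  (\esum_(x in P) 1 <= \esum_(x in Q) 1 :> \bar R)%E.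
Proof.
move=> PQ; apply: ge_ereal_sup => _ [F [finF FP] <-]; apply: ereal_sup_ubound.
by exists F => //; split => //; exact: subset_trans PQ.
Qed.

(** A relation stands in for an injection, so that no canonical image has to be named. Choice
    extracts a map from it, injective because no [y] is related to two elements of [P]. *)
Lemma esum1_rel (T T' : choiceType) (P : set T) (Q : set T') (r : T -> T' -> Prop) :
  (forall x, P x -> exists2 y, Q y & r x y) ->
  (forall x x' y, P x -> P x' -> r x y -> r x' y -> x = x') ->
  (\esum_(x in P) 1 <= \esum_(y in Q) 1 :> \bar R)%E.
Proof.
move=> tot inj; have [->|/set0P[x0 /tot[y0 _ _]]] := eqVneq P set0.
  by rewrite esum_set0 esum_ge0// => *; exact: lee01.
have /choice[f hf] : forall x, exists y, P x -> Q y /\ r x y.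
  move=> x; have [Px|nPx] := pselect (P x); last by exists y0.
  by have [y Qy rxy] := tot x Px; exists y.
rewrite -(esum_image P f (cst 1%E)); last first.
  move=> x x' /set_mem Px /set_mem Px' fxx'.
  by apply: (inj _ _ (f x)) => //; [exact: (hf x Px).2|rewrite fxx'; exact: (hf x' Px').2].
by apply: esum1_sub => _ [x Px <-]; exact: (hf x Px).1.
Qed.

Lemma esum1_finType (J : finType) (E : set J) :
  (\esum_(j in E) 1 = \sum_j (\1_E j)%:E :> \bar R)%E.
Proof.
rewrite esum_mkcond esum_fset; [|exact: finite_finset|by move=> j _; case: ifP].
have -> : [set: J] = [set` index_enum J].
  by apply/seteqP; split => // j _; rewrite /= mem_index_enum.
rewrite -fsbig_seq ?index_enum_uniq//.
by apply: eq_bigr => j _; rewrite indicE; case: (j \in E).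
Qed.

Lemma near_all_finite (T : choiceType) (A : set T) (Q : nat -> T -> Prop) :
  finite_set A -> (forall x, A x -> \forall n \near \oo, Q n x) ->
  \forall n \near \oo, forall x, A x -> Q n x.
Proof.
move=> /finite_seqP[s ->]; elim: s => [|x s IH] h; first exact: nearW.
have h1 : \forall n \near \oo, Q n x by apply: h; rewrite /= mem_head.
have h2 : \forall n \near \oo, forall y, [set` s] y -> Q n y.
  by apply: IH => y ys; apply: h; rewrite /= in_cons ys orbT.
near=> n => y /=; rewrite in_cons => /orP[/eqP ->|ys]; first by near: n.
by move: y ys; near: n.
Unshelve. all: by end_near. Qed.

Lemma finite_set_argmax (T : choiceType) (A : set T) (f : T -> R) :
  finite_set A -> A !=set0 -> exists2 x, A x & forall y, A y -> f y <= f x.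
Proof.
move=> /finite_seqP[s ->]; elim: s => [[]//|x [|y s] IH] _.
  by exists x; rewrite /= ?mem_head// => z; rewrite mem_seq1 => /eqP ->.
have [|z zs hz] := IH; first by exists y; rewrite /= mem_head.
have [xz|zx] := leP (f x) (f z).
  exists z; first by rewrite /= in_cons zs orbT.
  by move=> t /=; rewrite in_cons => /orP[/eqP ->//|/hz].
exists x; first by rewrite /= mem_head.
by move=> t /=; rewrite in_cons => /orP[/eqP ->//|/hz] => h; apply: le_trans (ltW zx).
Qed.

Local Notation pt := (R1 R * R1 R)%type.

Lemma npts0P (S B : set (R * R)) : npts S B = 0%E <-> S `&` B = set0.
Proof.
split => [h|SB]; last by rewrite /npts SB esum_set0.
apply/seteqP; split => // z Sz.
have : (\esum_(x in [set z]) 1 <= npts S B :> \bar R)%E by apply: esum1_sub => _ ->.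
by rewrite h esum_set1// lee_fin ler10.
Qed.

Lemma npts1P (S B : set (R * R)) :
  npts S B = 1%E <-> exists2 z, (S `&` B) z & forall z', (S `&` B) z' -> z' = z.
Proof.
split => [h|[z Sz hz]]; last first.
  rewrite /npts (_ : S `&` B = [set z]) ?esum_set1//.
  by apply/seteqP; split => [z' /hz ->//|_ ->].
have [e|/set0P[z Sz]] := eqVneq (S `&` B) set0.
  by move/npts0P : e; rewrite h => /eqP; rewrite eqe oner_eq0.
exists z => // z' Sz'; apply/eqP/negP => /negP z'z.
have : (\esum_(x in [set z; z']) 1 <= npts S B :> \bar R)%E.
  by apply: esum1_sub => _ [] ->.
rewrite h esum_fset//.
rewrite fsbigU0//=; [|exact: finite_set1..|].
  by rewrite !fsbig_set1 -EFinD lee_fin; lra.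
by move=> x [->/= e]; rewrite e eqxx in z'z.
Qed.

Lemma npts_fin (S B : set (R * R)) k : npts S B = k%:R%:E -> finite_set (S `&` B).
Proof.
move=> h; apply: contrapT => /infinite_set_fset.
move=> /(_ k.+1)[F FSB kF].
have : (\esum_(x in [set` finmap.enum_fset F]) 1 <= npts S B :> \bar R)%E by apply: esum1_sub.
rewrite h esum_fset// -fsbig_seq ?finmap.fset_uniq// sumEFin lee_fin.
have -> : \sum_(i <- finmap.enum_fset F) (1 : R) = (size (finmap.enum_fset F))%:R.
  by rewrite -sum1_size natr_sum.
by rewrite ler_nat leqNgt kF.
Qed.

End counting.

(** * Served pairs and cell events *)

Section signal.
Variables (R : realType) (beta : R).
Hypothesis beta_gt0 : 0 < beta.
Local Notation pt := (R * R)%type.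

(** On positive distances the power [beta] is strictly increasing and can be undone. At distance
    zero [powR] takes the value zero and the equivalence breaks down. *)
Lemma beatsP (PX PY : R) (X Y z : pt) : 0 < PX -> 0 < PY ->
  0 < dist2 X z -> 0 < dist2 Y z ->
  beats beta PX PY X Y z <-> (PY / PX) `^ beta^-1 * dist2 X z <= dist2 Y z.
Proof.
move=> PX0 PY0 X0 Y0; rewrite /beats !powRN ler_pdivrMr ?powR_gt0//.
rewrite mulrAC ler_pdivlMr ?powR_gt0//.
have q0 : 0 < PY / PX by rewrite divr_gt0.
have -> : (PY * dist2 X z `^ beta <= PX * dist2 Y z `^ beta) =
    (((PY / PX) `^ beta^-1 * dist2 X z) `^ beta <= dist2 Y z `^ beta).
  have -> : ((PY / PX) `^ beta^-1 * dist2 X z) `^ beta = PY / PX * dist2 X z `^ beta.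
    have X1 := ltW X0; have q1 := ltW q0.
    by rewrite powRM ?powR_ge0// -powRrM mulVf ?gt_eqF// powRr1.
  by rewrite mulrAC ler_pdivrMr// [_ * PX]mulrC.
have nX : (PY / PX) `^ beta^-1 * dist2 X z \is Num.nneg.
  by rewrite nnegrE mulr_ge0 ?powR_ge0// ltW.
have nY : dist2 Y z \is Num.nneg by rewrite nnegrE ltW.
split => [|h]; last by apply: ge0_ler_powR => //; exact: ltW.
apply: contraTT; rewrite -!ltNge => h.
exact: gt0_ltr_powR.
Qed.

End signal.

Section configuration.
Variables (R : realType) (beta : R) (pw : bool -> R).
Hypothesis beta_gt0 : 0 < beta.
Hypothesis pw_gt0 : forall b, 0 < pw b.
Variables (St : bool -> set (R * R)) (U : set (R * R)).
Local Notation pt := (R * R)%type.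
Local Notation Sq := (@unit_square R).

(** The ratio of distances at which the received powers balance: a user at distance $r>0$ from its
    station of tier [b] tolerates stations of tier [b'] at distances from [reach b b'] times $r$
    on. *)
Definition reach (b b' : bool) : R := (pw b' / pw b) `^ beta^-1.

Lemma reach_gt0 b b' : 0 < reach b b'.
Proof. by rewrite powR_gt0// divr_gt0. Qed.

Lemma reach_id b : reach b b = 1.
Proof. by rewrite /reach divff ?powR1// gt_eqF. Qed.

Lemma reachK b b' : reach b b' * reach b' b = 1.
Proof.
rewrite /reach -powRM ?divr_ge0 ?ltW// mulrA divfK ?gt_eqF// divff ?powR1//.
by rewrite gt_eqF.
Qed.

Definition covers (b : bool) (X z : pt) :=
  forall b' Y, St b' Y -> beats beta (pw b) (pw b') X Y z.

Definition same_cell (u v : pt) :=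
  exists b X, [/\ St b X, covers b X u & covers b X v].

Definition served_pairs : set (pt * pt) :=
  [set p | [/\ U p.1, Sq p.1, U p.2 & same_cell p.1 p.2]].

(** A competitor at [z] itself has power zero there and imposes nothing, whence [Y <> z]. If [X] is
    at [z], the left side is zero. *)
Lemma covers_near b b' X Y z : covers b X z -> St b' Y -> Y <> z ->
  reach b b' * dist2 X z <= dist2 Y z.
Proof.
move=> cX SY Yz; have Y0 := dist2_gt0 Yz.
have [X0|X0] := ltP 0 (dist2 X z); first by apply/beatsP => //; exact: cX.
have -> : dist2 X z = 0 by apply/eqP; rewrite eq_le X0 dist2_ge0.
by rewrite mulr0 dist2_ge0.
Qed.

(** The supremum of the received powers is attained: the stations at least as strong at [u] as a
    given one of positive power lie in a bounded disc, hence are finitely many. *)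
Lemma exists_covering : (forall b K, finite_set (St b `&` window K)) ->
  (exists b X, St b X) -> forall u, exists b X, St b X /\ covers b X u.
Proof.
move=> fin ex u.
pose power (s : bool * pt) := pw s.1 * dist2 s.2 u `^ (- beta).
have p0 s : 0 <= power s by rewrite mulr_ge0 ?powR_ge0 ?ltW.
have [[[b1 X1] /= [S1 p1]]|nex] := pselect (exists s, St s.1 s.2 /\ 0 < power s); last first.
  (* No station has positive power at [u], so all powers vanish and any station will do. *)
  have [b [X SX]] := ex; exists b, X; split => // b' Y SY.
  rewrite /beats; apply: (le_trans _ (p0 (b, X))).
  by rewrite leNgt; apply/negP => h; apply: nex; exists (b', Y).
have dgt s : 0 < power s -> 0 < dist2 s.2 u.
  rewrite /power => h; rewrite lt0r dist2_ge0 andbT; apply/eqP => e.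
  by move: h; rewrite e powR0 ?mulr0 ?ltxx// oppr_eq0 gt_eqF.
pose A := [set s : bool * pt | St s.1 s.2 /\ power (b1, X1) <= power s].
have bnd s : A s -> dist2 s.2 u <= dist2 X1 u / reach s.1 b1.
  case: s => b X [SX /= hX].
  have X0 : 0 < dist2 X u by apply: (dgt (b, X)); exact: lt_le_trans hX.
  have := (beatsP beta_gt0 (pw_gt0 b) (pw_gt0 b1) X0 (dgt (b1, X1) p1)).1 hX.
  by rewrite ler_pdivlMr ?reach_gt0// mulrC.
(* The radius in [bnd] depends on the tier; the sum dominates both values. *)
pose r := dist2 X1 u / reach true b1 + dist2 X1 u / reach false b1.
have bnd' s : A s -> dist2 s.2 u <= r.
  move=> /bnd h; apply: (le_trans h); rewrite /r.
  by case: (s.1); rewrite ?lerDl ?lerDr divr_ge0 ?dist2_ge0// ltW// reach_gt0.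
have [K hK] : exists K, forall X, dist2 X u <= r -> window K X.
  exists (Num.truncn (`|u.1| + `|u.2| + r)).+1 => X hX.
  have [h1 h2] := ler_abs_dist2 X u.
  have t := truncnS_gt (`|u.1| + `|u.2| + r).
  have n1 := normr_ge0 u.1; have n2 := normr_ge0 u.2.
  have t1 : `|X.1| <= `|X.1 - u.1| + `|u.1| by rewrite -{1}(subrK u.1 X.1) ler_normD.
  have t2 : `|X.2| <= `|X.2 - u.2| + `|u.2| by rewrite -{1}(subrK u.2 X.2) ler_normD.
  have g1 : `|X.1| < (Num.truncn (`|u.1| + `|u.2| + r)).+1%:R by lra.
  have g2 : `|X.2| < (Num.truncn (`|u.1| + `|u.2| + r)).+1%:R by lra.
  move: g1 g2; rewrite !ltr_norml => /andP[/ltW a1 a2] /andP[/ltW a3 a4].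
  by split; rewrite /= in_itv/= ?a1 ?a2 ?a3 ?a4.
have finA : finite_set A.
  apply: (@sub_finite_set _ _ ([set true] `*` (St true `&` window K) `|`
                               [set false] `*` (St false `&` window K))).
    move=> [b X] As; have := hK _ (bnd' _ As); case: As => /= SX _ wX.
    by case: b SX => SX; [left|right].
  by rewrite finite_setU; split; apply: finite_setX => //; exact: fin.
have [|[b X] [/= SX hX] mX] := finite_set_argmax power finA; first by exists (b1, X1).
exists b, X; split; first exact: SX.
move=> b' Y SY; rewrite /beats.
have [h|h] := leP (power (b1, X1)) (power (b', Y)); first exact: (mX (b', Y)).
exact: (le_trans (ltW h) hX).
Qed.

Variables (K n : nat).

(** A point is within $2\,$[mesh] of the corner of its cell. Moving station and user to their
    corners changes [reach] times their distance by at most $4\,$[mesh] times [reach], and the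
    distance from the user to a competitor by at most $2\,$[mesh]. The spare $2\,$[mesh] makes the
    inequality strict for the shrunk discs as well. *)
Definition slack (b b' : bool) : R := (2 * reach b b' + 2) * (2 * mesh R n).

Definition outer (b b' : bool) (t : triples K n) : set pt :=
  disc_pair (reach b b') (slack b b') (corner t.1) (corner t.2.1) (corner t.2.2).

Definition inner (b b' : bool) (t : triples K n) : set pt :=
  disc_pair (reach b b') (- slack b b') (corner t.1) (corner t.2.1) (corner t.2.2).

Definition cells_of (t : triples K n) : set pt :=
  cell t.1 `|` cell t.2.1 `|` cell t.2.2.

Lemma outerP b b' (t : triples K n) X u v Y :
  cell t.1 X -> cell t.2.1 u -> cell t.2.2 v -> ~ outer b b' t Y ->
  reach b b' * dist2 X u < dist2 Y u /\ reach b b' * dist2 X v < dist2 Y v.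
Proof.
move=> tX tu tv nY.
have r0 := reach_gt0 b b'; have m0 := mesh_gt0 R n.
have P (c : cells K n) z : cell c z ->
    ~ disc (corner c) (reach b b' * dist2 (corner t.1) (corner c) + slack b b') Y ->
    reach b b' * dist2 X z < dist2 Y z.
  move=> cz /negP; rewrite /disc/= -ltNge => h.
  have d1 := dist2_corner tX; have d2 := dist2_corner cz.
  have t1 := dist2_triangle z (corner c) Y.
  rewrite (dist2C (corner c) z) (dist2C z Y) in t1.
  have t2 := dist2_triangle (corner t.1) X z; have t3 := dist2_triangle (corner c) (corner t.1) z.
  rewrite (dist2C (corner c) z) in t3.
  have : reach b b' * dist2 X z <= reach b b' * (dist2 (corner t.1) (corner c) + 4 * mesh R n).
    by rewrite ler_pM2l//; lra.
  by rewrite /slack in h; nra.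
by split; [apply: (P _ _ tu)|apply: (P _ _ tv)] => h; apply: nY; [left|right].
Qed.

Lemma innerP b b' (t : triples K n) X u v Y :
  cell t.1 X -> cell t.2.1 u -> cell t.2.2 v -> inner b b' t Y ->
  dist2 Y u < reach b b' * dist2 X u \/ dist2 Y v < reach b b' * dist2 X v.
Proof.
move=> tX tu tv iY.
have r0 := reach_gt0 b b'; have m0 := mesh_gt0 R n.
have P (c : cells K n) z : cell c z ->
    disc (corner c) (reach b b' * dist2 (corner t.1) (corner c) - slack b b') Y ->
    dist2 Y z < reach b b' * dist2 X z.
  move=> cz; rewrite /disc/= => h.
  have d1 := dist2_corner tX; have d2 := dist2_corner cz.
  have t1 := dist2_triangle (corner c) z Y.
  rewrite (dist2C z Y) in t1.
  have t2 := dist2_triangle X (corner t.1) (corner c).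
  have t3 := dist2_triangle z X (corner c).
  rewrite (dist2C (corner t.1) X) in t2.
  have : reach b b' * dist2 (corner t.1) (corner c) <= reach b b' * (dist2 X z + 4 * mesh R n).
    by rewrite ler_pM2l//; lra.
  by rewrite /slack in h; nra.
by case: iY => h; [left|right]; exact: P h.
Qed.

(* [inl (b, t)] stands for pairs of distinct users in the last two cells of [t]
   served by a station of tier [b] (macro for [true]) in the first one; [inr c]
   stands for the diagonal pairs, a user being counted with itself. *)
Definition event (mask : triples K n -> bool) (V1 V2 : bool -> triples K n -> set pt)
    (j : bool * triples K n + cells K n) : Prop :=
  match j with
  | inr c => npts U (cell c `&` Sq) = 1%E
  | inl (b, t) => mask t /\
      [/\ npts (St b) (cell t.1) = 1%E, npts (St b) (V1 b t) = 0%E,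
          npts (St (~~ b)) (V2 b t) = 0%E,
          npts U (cell t.2.1 `&` Sq) = 1%E & npts U (cell t.2.2) = 1%E]
  end.

Definition distinct_cells (t : triples K n) : bool :=
  [&& t.1 != t.2.1, t.1 != t.2.2 & t.2.1 != t.2.2].

(** The station lies in the discs of its own tier, so its cell is cut out of that void region; the
    region of the other tier stays whole. *)
Definition lower_event := event distinct_cells
  (fun b t => outer b b t `\` cell t.1) (fun b t => outer b (~~ b) t).

(** The user cells are cut out too, because a station at the very position of a user has zero power
    for that user and may be present. The serving station may share a cell with a user, so the mask
    separates only the two users. *)
Definition upper_event := event (fun t => t.2.1 != t.2.2)
  (fun b t => inner b b t `\` cells_of t) (fun b t => inner b (~~ b) t `\` cells_of t).

Lemma lower_event_station b t : lower_event (inl (b, t)) ->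
  exists X u v, [/\ St b X, cell t.1 X, U u /\ Sq u /\ cell t.2.1 u, U v /\ cell t.2.2 v &
    forall b' Y, St b' Y -> (b', Y) = (b, X) \/
      (reach b b' * dist2 X u < dist2 Y u /\ reach b b' * dist2 X v < dist2 Y v)].
Proof.
move=> [_ [/npts1P[X [SX tX] uX] /npts0P h1 /npts0P h2 /npts1P[u [Uu [tu Squ]] _]
  /npts1P[v [Uv tv] _]]].
exists X, u, v; split => // b' Y SY.
have [e|e] := eqVneq b' b.
  subst b'; have [YX|nYX] := pselect (cell t.1 Y).
    by left; rewrite (uX Y).
  right; apply: (outerP tX tu tv) => oY.
  have : (St b `&` (outer b b t `\` cell t.1)) Y by [].
  by rewrite h1.
have {}e : b' = ~~ b by case: b b' e {h1 h2 uX SX SY} => -[].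
subst b'; right; apply: (outerP tX tu tv) => oY.
have : (St (~~ b) `&` outer b (~~ b) t) Y by [].
by rewrite h2.
Qed.

(** A pair determines its event. For an off-diagonal event, the station wins strictly at the first
    user against all others; two such stations would contradict [reachK], so tier and station agree,
    and then the cells do. Distinct user cells keep these events apart from the diagonal ones, for
    which the covering hypothesis supplies a station. *)
Lemma lower_count : (forall u, exists b X, St b X /\ covers b X u) ->
  (\sum_j (\1_lower_event j)%:E <= \esum_(p in served_pairs) 1 :> \bar R)%E.
Proof.
move=> cov; rewrite -esum1_finType.
pose r (j : bool * triples K n + cells K n) (p : pt * pt) := match j with
  | inr c => p.1 = p.2 /\ cell c p.1
  | inl (b, t) => cell t.2.1 p.1 /\ cell t.2.2 p.2 /\ exists X, St b X /\ cell t.1 X /\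
      forall b' Y, St b' Y -> (b', Y) = (b, X) \/ reach b b' * dist2 X p.1 < dist2 Y p.1
  end.
apply: (@esum1_rel _ _ _ _ _ r).
  case=> [[b t] ev|c]; last first.
    move=> /npts1P[u [Uu [cu Squ]] _]; exists (u, u) => //; split => //.
    by have [b [X [SX cX]]] := cov u; exists b, X.
  have [X [u [v [SX tX [Uu [Squ tu]] [Uv tv] far]]]] := lower_event_station ev.
  case: ev => /and3P[d1 d2 d3] _.
  exists (u, v) => /=; last first.
    split => //; split => //; exists X; split => //; split => // b' Y /far[|[h _]]; by [left|right].
  split => //; exists b, X; split => // b' Y SY.
    have [[-> ->]|[h _]] := far _ _ SY; first exact: lexx.
    have X0 : 0 < dist2 X u.
      by apply: dist2_gt0 => e; move: d1; rewrite (cell_inj tX (c' := t.2.1)) ?eqxx// e.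
    apply/beatsP => //; last exact: ltW.
    by apply: le_lt_trans h; rewrite mulr_ge0 ?dist2_ge0// ltW// reach_gt0.
  have [[-> ->]|[_ h]] := far _ _ SY; first exact: lexx.
  have X0 : 0 < dist2 X v.
    by apply: dist2_gt0 => e; move: d2; rewrite (cell_inj tX (c' := t.2.2)) ?eqxx// e.
  apply/beatsP => //; last exact: ltW.
  by apply: le_lt_trans h; rewrite mulr_ge0 ?dist2_ge0// ltW// reach_gt0.
move=> [[b t]|c] [[b' t']|c'] p ev ev' /=; last 3 first.
- move=> [h1 [h2 _]] [e h3]; case: ev => /and3P[_ _ /eqP[]].
  by apply: cell_inj h1 _; rewrite e.
- move=> [e h3] [h1 [h2 _]]; case: ev' => /and3P[_ _ /eqP[]].
  by apply: cell_inj h1 _; rewrite e.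
- by move=> [_ h] [_ h']; rewrite (cell_inj h h').
move=> [h1 [h2 [X [SX [tX fX]]]]] [h1' [h2' [X' [SX' [tX' fX']]]]].
have e : (b', X') = (b, X).
  have [//|l1] := fX _ _ SX'; have [//|l2] := fX' _ _ SX.
  have r0 := reach_gt0 b' b.
  have : reach b' b * (reach b b' * dist2 X p.1) < reach b' b * dist2 X' p.1 by rewrite ltr_pM2l.
  by rewrite mulrA reachK mul1r => /lt_trans /(_ l2); rewrite ltxx.
case: e => eb eX; rewrite eb; congr (inl (_, _)).
case: t t' {ev ev' fX fX'} h1 h2 h1' h2' tX tX' => [a [c d]] [a' [c' d']] /= h1 h2 h1' h2' tX tX'.
by rewrite (cell_inj h1 h1') (cell_inj h2 h2'); rewrite eX in tX'; rewrite (cell_inj tX tX').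
Qed.

Lemma upper_event_inl b t X u v :
  (forall S, S = U \/ (exists b', S = St b') -> forall x y (c : cells K n), S x -> S y ->
    cell c x -> cell c y -> x = y) ->
  u <> v -> U u -> Sq u -> U v -> St b X -> covers b X u -> covers b X v ->
  cell t.1 X -> cell t.2.1 u -> cell t.2.2 v -> upper_event (inl (b, t)).
Proof.
move=> sep uv Uu Squ Uv SX cu cv tX tu tv.
have sepU := sep U (or_introl erefl).
have sepS b' := sep (St b') (or_intror (ex_intro _ b' erefl)).
(* A station in the shrunk discs and outside the cells of the triple is at neither user, hence
   strictly stronger than [X] at one of them, against [covers]. *)
have void b' : npts (St b') (inner b b' t `\` cells_of t) = 0%E.
  apply/npts0P/seteqP; split => // Y [SY [iY nY]].
  have Yu : Y <> u by move=> e; apply: nY; left; right; rewrite e.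
  have Yv : Y <> v by move=> e; apply: nY; right; rewrite e.
  have h1 := covers_near cu SY Yu; have h2 := covers_near cv SY Yv.
  by have [h|h] := innerP tX tu tv iY; [move: h1|move: h2]; rewrite leNgt h.
split.
  apply/eqP => e; apply: uv; apply: (sepU _ _ t.2.1) => //; by rewrite e.
split; [|exact: void..| |].
- by apply/npts1P; exists X => // X' [SX' tX']; exact: (sepS b _ _ t.1).
- by apply/npts1P; exists u => // u' [Uu' [tu' _]]; exact: (sepU _ _ t.2.1).
- by apply/npts1P; exists v => // v' [Uv' tv']; exact: (sepU _ _ t.2.2).
Qed.

(** The first hypothesis says that no cell holds two points of the same process. A pair is then
    recovered from its user cells alone, so that any one of its serving stations may be used to form
    the event. *)
Lemma upper_count (F : set (pt * pt)) :
  (forall S, S = U \/ (exists b', S = St b') -> forall x y (c : cells K n), S x -> S y ->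
    cell c x -> cell c y -> x = y) ->
  F `<=` served_pairs ->
  (forall p, F p -> [/\ window K p.1, window K p.2 & exists b X,
     [/\ St b X, window K X, covers b X p.1 & covers b X p.2]]) ->
  (\esum_(p in F) 1 <= \sum_j (\1_upper_event j)%:E :> \bar R)%E.
Proof.
move=> sep FA FW; rewrite -esum1_finType.
have sepU := sep U (or_introl erefl).
pose r (p : pt * pt) (j : bool * triples K n + cells K n) := match j with
  | inr c => p.1 = p.2 /\ cell c p.1
  | inl (b, t) => cell t.2.1 p.1 /\ cell t.2.2 p.2
  end.
apply: (@esum1_rel _ _ _ _ _ r).
  move=> [u v] Fp; have [/= wu wv [b [X [SX wX cu cv]]]] := FW _ Fp.
  have [/= Uu Squ Uv _] := FA _ Fp.
  have [c1 hX] := cell_cover n wX; have [c2 hu] := cell_cover n wu.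
  have [c3 hv] := cell_cover n wv.
  have [e|e] := pselect (u = v).
    exists (inr c2) => //; apply/npts1P; exists u => // u' [Uu' [tu' _]].
    exact: (sepU _ _ c2).
  exists (inl (b, (c1, (c2, c3)))); last by split.
  exact: (upper_event_inl (t := (c1, (c2, c3))) sep e Uu Squ Uv SX cu cv hX hu hv).
move=> [u v] [u' v'] [[b t]|c] /FA[/= Uu _ Uv _] /FA[/= Uu' _ Uv' _] /=.
  move=> [h1 h2] [h3 h4]; congr (_, _); first exact: (sepU _ _ t.2.1).
  exact: (sepU _ _ t.2.2).
by move=> [<- h1] [<- h2]; rewrite (sepU u u' c).
Qed.

End configuration.

(** * The Palm sum *)

Section palm_sum.
Variables (R : realType) (beta Pmac Pmic : R) (Smac Smic U : set (R * R)).
Local Notation pt := (R * R)%type.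
Local Notation pw := (fun b : bool => if b then Pmac else Pmic).
Local Notation St := (fun b : bool => if b then Smac else Smic).

Lemma beats_translate PX PY (X Y z u : pt) :
  beats beta PX PY (translate u X) (translate u Y) (translate u z) =
  beats beta PX PY X Y z.
Proof.
have E w : dist2 (translate u w) (translate u z) = dist2 w z.
  by rewrite /dist2/=; congr (Num.sqrt _); ring.
by rewrite /beats !E.
Qed.

Lemma shiftE (S : set pt) u z : Defs.shift S u z = S (translate u z).
Proof. by []. Qed.

Lemma translateK (u z : pt) : translate u (sub2 z u) = z.
Proof. by case: z => z1 z2; rewrite /translate/= !subrK. Qed.

Lemma sub2K (u z : pt) : sub2 (translate u z) u = z.
Proof. by case: z => z1 z2; rewrite /sub2/= !addrK. Qed.

Lemma hetcell_translate (b : bool) (u X z : pt) :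
  hetcell beta Pmac Pmic (Defs.shift Smac u) (Defs.shift Smic u) X (pw b) z <->
  covers beta pw St b (translate u X) (translate u z).
Proof.
split => [[h1 h2] [] Y SY /=|h].
- rewrite -(translateK u Y) beats_translate; apply: h1.
  by rewrite shiftE translateK.
- rewrite -(translateK u Y) beats_translate; apply: h2.
  by rewrite shiftE translateK.
- by split => Y SY; rewrite -(beats_translate _ _ _ _ _ u); [exact: (h true)|exact: (h false)].
Qed.

Lemma hetcell_at_translate (u v : pt) :
  hetcell_at beta Pmac Pmic (Defs.shift Smac u) (Defs.shift Smic u) (0, 0) (sub2 v u) <->
  same_cell beta pw St u v.
Proof.
have E0 : translate u (0, 0) = u by case: u => u1 u2; rewrite /translate/= !add0r.
split.
  move=> [X [[SX [h1 h2]]|[SX [h1 h2]]]].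
    exists true, (translate u X); split; first exact: SX.
      by have := (hetcell_translate true u X (0, 0)).1 h1; rewrite E0.
    by have := (hetcell_translate true u X (sub2 v u)).1 h2; rewrite translateK.
  exists false, (translate u X); split; first exact: SX.
    by have := (hetcell_translate false u X (0, 0)).1 h1; rewrite E0.
  by have := (hetcell_translate false u X (sub2 v u)).1 h2; rewrite translateK.
move=> [b [X [SX h1 h2]]]; exists (sub2 X u).
case: b SX h1 h2 => SX h1 h2; [left|right].
  split; first by rewrite shiftE translateK.
  split; [apply/(hetcell_translate true)|apply/(hetcell_translate true)];
    by rewrite !translateK ?E0.
split; first by rewrite shiftE translateK.
split; [apply/(hetcell_translate false)|apply/(hetcell_translate false)];
  by rewrite !translateK ?E0.
Qed.

(** The substitution $v=u+z$ undoes the recentring: the cell of the origin becomes the relation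
    [same_cell] between [u] and [v], and the double sum becomes a sum over pairs. *)
Lemma palm_sumE :
  (\esum_(u in U `&` @unit_square R)
     users_in_cell0 beta Pmac Pmic (Defs.shift Smac u) (Defs.shift Smic u) (Defs.shift U u) =
   \esum_(p in served_pairs beta pw St U) 1)%E.
Proof.
transitivity (\esum_(u in U `&` @unit_square R)
    \esum_(v in [set v | U v /\ same_cell beta pw St u v]) (1 : \bar R))%E.
  apply: eq_esum => u _; rewrite /users_in_cell0 /npts.
  apply: (@reindex_esum R _ _ [set v | U v /\ same_cell beta pw St u v] _
    (fun v => sub2 v u) (fun=> 1%E)); split.
  - move=> v [/= Uv suv]; split; first by rewrite shiftE translateK.
    exact/hetcell_at_translate.
  - by move=> v w _ _ /(congr1 (translate u)); rewrite !translateK.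
  - move=> z [/= Uz hz]; exists (translate u z); last exact: sub2K.
    by split => //; apply/hetcell_at_translate; rewrite sub2K.
rewrite esum_esum//; congr esum; apply/seteqP; split => p; rewrite /served_pairs /=.
  by move=> [[? ?] [? ?]].
by move=> [? ? ? ?].
Qed.

End palm_sum.

(** * Comparison of integrals off a null set *)

Section lower_integral.
Local Open Scope ereal_scope.
Context d (T : measurableType d) (R : realType) (mu : {measure set T -> \bar R}).
Implicit Types f g : T -> \bar R.

(* [\int] of a nonnegative function is a supremum over simple functions below
   it, hence monotone even without measurability. *)
Lemma le_lower_integral f g : (forall x, 0 <= f x) -> (forall x, f x <= g x) ->
  \int[mu]_x f x <= \int[mu]_x g x.
Proof.
move=> f0 fg; have g0 x : 0 <= g x by exact: le_trans (fg x).
rewrite !ge0_integralTE//; apply: ereal_sup_le => _ [h hf <-].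
by exists h => // x; exact: le_trans (fg x).
Qed.

(** The measurable [f] is lowered to zero on the null set, which keeps its integral; monotonicity
    then gives the bound. *)
Lemma ae_ge_lower_integral f g (N : set T) : measurable N -> mu N = 0 ->
  measurable_fun setT f -> (forall x, 0 <= f x) -> (forall x, 0 <= g x) ->
  (forall x, ~ N x -> f x <= g x) -> \int[mu]_x f x <= \int[mu]_x g x.
Proof.
move=> mN N0 mf f0 g0 fg.
have mC : measurable (~` N) by exact: measurableC.
have mr : measurable_fun setT (f \_ (~` N)).
  by apply/(measurable_restrictT _ _).1 => //; exact: measurable_funTS.
have -> : \int[mu]_x f x = \int[mu]_x (f \_ (~` N)) x.
  apply: ge0_ae_eq_integral => //.
    by move=> x _; exact: erestrict_ge0.
  exists N; split => // x /=; apply: contra_notP => nx _.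
  by rewrite patchE mem_set.
apply: le_lower_integral => x; first exact: erestrict_ge0.
by rewrite patchE; case: ifPn => // /set_mem; exact: fg.
Qed.

(** Dually, the measurable [g] is raised to infinity on the null set, at no cost to its integral. *)
Lemma ae_le_lower_integral f g (N : set T) : measurable N -> mu N = 0 ->
  measurable_fun setT g -> (forall x, 0 <= f x) -> (forall x, 0 <= g x) ->
  (forall x, ~ N x -> f x <= g x) -> \int[mu]_x f x <= \int[mu]_x g x.
Proof.
move=> mN N0 mg f0 g0 fg.
pose g' x := (g \_ (~` N)) x + ((cst +oo) \_ N) x.
have mC : measurable (~` N) by exact: measurableC.
have g'0 x : 0 <= g' x.
  by apply: adde_ge0; apply: erestrict_ge0 => // t _; exact: le0y.
have mg' : measurable_fun setT g'.
  apply: emeasurable_funD; apply/(measurable_restrictT _ _).1 => //.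
  exact: measurable_funTS.
have -> : \int[mu]_x g x = \int[mu]_x g' x.
  apply: ge0_ae_eq_integral => //.
  exists N; split => // x /=; apply: contra_notP => nx _.
  by rewrite /g' !patchE mem_set// memNset// adde0.
apply: le_lower_integral => // x; rewrite /g' !patchE.
have [Nx|nN] := pselect (N x); first by rewrite memNset ?mem_set// add0e leey.
by rewrite mem_set// memNset// adde0 fg.
Qed.

End lower_integral.

(** * Almost sure properties of the point processes *)

Section liminf.
Local Open Scope ereal_scope.
Variable R : realType.

Lemma le_limn_einf (u : nat -> \bar R) x :
  (\forall n \near \oo, x <= u n) -> x <= limn_einf u.
Proof.
move=> [N _ h]; rewrite limn_einf_lim; apply: lime_ge; first exact: is_cvg_einfs.
exists N => // n /= Nn; apply: le_ereal_inf_tmp => _ [k /= nk <-].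
by apply: h => /=; exact: leq_trans nk.
Qed.

Lemma limn_einf_le (u v : nat -> \bar R) l :
  (forall n, u n <= v n) -> v n @[n --> \oo] --> l -> limn_einf u <= l.
Proof.
move=> uv vl; rewrite limn_einf_lim -(cvg_lim _ vl)//.
apply: lee_lim; [exact: is_cvg_einfs|by apply/cvg_ex; exists l|].
apply: nearW => n; apply: le_trans (uv n); apply: ge_ereal_inf.
by exists (u n) => //; exists n => /=.
Qed.

Lemma measurable_limn_einf d (T : measurableType d) (f : nat -> T -> \bar R) :
  (forall n, measurable_fun setT (f n)) ->
  measurable_fun setT (fun x => limn_einf (f ^~ x)).
Proof.
move=> mf; rewrite /limn_einf.
have m : measurable_fun setT (-%E : \bar R -> \bar R) by exact: oppe_measurable.
have := @measurable_fun_limn_esup _ T R setT (fun n x => - f n x)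
  (fun n => measurableT_comp m (mf n)).
exact: (measurableT_comp m).
Qed.

End liminf.

Section poisson_points.
Context (R : realType) d (Omega : measurableType d) (P : probability Omega R).
Variables (Phi : bool -> Omega -> set (R * R)) (U : Omega -> set (R * R)).
Variables (l : bool -> R) (lU : R).
Local Notation pt := (R1 R * R1 R)%type.
Local Notation Sq := (@unit_square R).
Hypothesis l_gt0 : forall b, 0 < l b.
Hypothesis lU_gt0 : 0 < lU.
Hypothesis hPPP : indep_hPPPs P
  (fun i : 'I_3 => nth (fun _ => set0) [:: Phi true; Phi false; U] i)
  (fun i : 'I_3 => nth 0 [:: l true; l false; lU] i).

Definition station_idx (b : bool) : 'I_3 := if b then @Ordinal 3 0 isT else @Ordinal 3 1 isT.
Definition user_idx : 'I_3 := @Ordinal 3 2 isT.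

Lemma measurable_npts_station b (A : set pt) (k : \bar R) : measurable A ->
  measurable [set w | npts (Phi b w) A = k].
Proof.
move=> mA; have h := hPPP.1 (station_idx b) A mA.
have := h measurableT _ (emeasurable_set1 k); rewrite setTI.
by case: b h.
Qed.

Lemma measurable_npts_user (A : set pt) (k : \bar R) : measurable A ->
  measurable [set w | npts (U w) A = k].
Proof.
move=> mA; have h := hPPP.1 user_idx A mA.
by have := h measurableT _ (emeasurable_set1 k); rewrite setTI.
Qed.

Lemma poisson_law0 (m : R) : poisson_law m 0 = expR (- m).
Proof. by rewrite /poisson_law expr0 fact0 divr1 mul1r. Qed.

Lemma poisson_law1 (m : R) : poisson_law m 1 = m * expR (- m).
Proof. by rewrite /poisson_law expr1 divr1. Qed.

Lemma prob_single (i : 'I_3) (A : set pt) k : measurable A -> (leb2 A < +oo)%E ->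
  P [set w | npts (nth (fun _ => set0) [:: Phi true; Phi false; U] i w) A = k%:R%:E] =
  (poisson_law (nth 0 [:: l true; l false; lU] i * area A) k)%:E.
Proof.
move=> mA fA.
have := hPPP.2 1%N (fun=> i) (fun=> A) (fun=> k) (fun=> conj mA fA).
rewrite big_ord1 => <-; last by move=> [[|//] ?] [[|//] ?].
by congr (P _); apply/seteqP; split => w /=; [move=> h j _|move=> /(_ ord0 I)].
Qed.

(** The joint law asks for disjointness only inside one process: [A] and [V1] belong to tier [b],
    [B1] and [B2] to the users, whereas [V2] concerns the other tier and may meet any of them. *)
Lemma prob_joint b (A V1 V2 B1 B2 : set pt) :
  measurable A -> (leb2 A < +oo)%E -> measurable V1 -> (leb2 V1 < +oo)%E ->
  measurable V2 -> (leb2 V2 < +oo)%E -> measurable B1 -> (leb2 B1 < +oo)%E ->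
  measurable B2 -> (leb2 B2 < +oo)%E -> A `&` V1 = set0 -> B1 `&` B2 = set0 ->
  P [set w | [/\ npts (Phi b w) A = 1%E, npts (Phi b w) V1 = 0%E,
                npts (Phi (~~ b) w) V2 = 0%E, npts (U w) B1 = 1%E & npts (U w) B2 = 1%E]] =
  (poisson_law (l b * area A) 1 * poisson_law (l b * area V1) 0 *
   poisson_law (l (~~ b) * area V2) 0 * poisson_law (lU * area B1) 1 *
   poisson_law (lU * area B2) 1)%:E.
Proof.
move=> mA fA mV1 fV1 mV2 fV2 mB1 fB1 mB2 fB2 AV B12.
pose idx (j : 'I_5) := nth user_idx
  [:: station_idx b; station_idx b; station_idx (~~ b); user_idx; user_idx] j.
pose B (j : 'I_5) := nth set0 [:: A; V1; V2; B1; B2] j.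
pose k (j : 'I_5) := nth 0%N [:: 1; 0; 0; 1; 1]%N j.
have H := hPPP.2 5%N idx B k.
have prod5 (f : 'I_5 -> R) : \prod_(j < 5) f j = f (@Ordinal 5 0 isT) *
    f (@Ordinal 5 1 isT) * f (@Ordinal 5 2 isT) * f (@Ordinal 5 3 isT) * f (@Ordinal 5 4 isT).
  rewrite !big_ord_recr big_ord0 /= mul1r.
  by congr (f _ * f _ * f _ * f _ * f _); exact: val_inj.
have E : \bigcap_(j in [set: 'I_5]) [set w | npts (nth (fun=> set0)
      [:: Phi true; Phi false; U] (idx j) w) (B j) = (k j)%:R%:E] =
    [set w | [/\ npts (Phi b w) A = 1%E, npts (Phi b w) V1 = 0%E,
                npts (Phi (~~ b) w) V2 = 0%E, npts (U w) B1 = 1%E & npts (U w) B2 = 1%E]].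
  apply/seteqP; split => w /=.
    move=> h.
    have h0 := h (@Ordinal 5 0 isT) I; have h1 := h (@Ordinal 5 1 isT) I.
    have h2 := h (@Ordinal 5 2 isT) I; have h3 := h (@Ordinal 5 3 isT) I.
    have h4 := h (@Ordinal 5 4 isT) I.
    by move: h0 h1 h2 h3 h4; rewrite /idx /B /k /=; case: (b).
  move=> [h0 h1 h2 h3 h4] [[|[|[|[|[|//]]]]] i] _; rewrite /idx /B /k /=;
    by move: h0 h1 h2 h3 h4; case: (b).
rewrite -E H; [|move|].
- rewrite prod5 /idx /B /k /area /=.
  by case: (b).
- by move=> [[|[|[|[|[|?]]]]] i]; [exact: (conj mA fA)|exact: (conj mV1 fV1)|
    exact: (conj mV2 fV2)|exact: (conj mB1 fB1)|exact: (conj mB2 fB2)|].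
- move=> [[|[|[|[|[|//]]]]] i] [[|[|[|[|[|//]]]]] i'] //; rewrite /idx /B /=;
    rewrite ?(setIC V1) ?(setIC B2) ?AV ?B12//; by case: (b).
Qed.

(** The Poisson weights sum to 1. The index [K.+1] keeps the area of the window, hence the Poisson
    mean, positive. *)
Lemma npts_fin_num_prob (i : 'I_3) K :
  P (\bigcup_k [set w | npts (nth (fun _ => set0) [:: Phi true; Phi false; U] i w)
      (window K.+1) = k%:R%:E]) = 1%E.
Proof.
set X := nth _ _ i; set m := nth 0 [:: l true; l false; lU] i.
have m0 : 0 < m by rewrite /m; case: (i) => -[|[|[|//]]] ?; [exact: l_gt0..|].
have mW := @measurable_window R K.+1.
have fW : (leb2 (window K.+1 : set pt) < +oo)%E by rewrite leb2_window ltry.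
have aW : 0 < area (window K.+1 : set pt).
  by rewrite /area leb2_window/= exprn_gt0// mulr_gt0// ltr0n.
rewrite measure_bigcup//; last 2 first.
- move=> k _; have := hPPP.1 i _ mW => h.
  by have := h measurableT _ (emeasurable_set1 k%:R%:E); rewrite setTI.
- apply/trivIsetP => k k' _ _ kk'; apply/seteqP; split => // w /= [-> /eqP].
  by rewrite eqe eqr_nat (negbTE kk').
rewrite (eq_eseriesr (g := fun k => (poisson_pmf (m * area (window K.+1)) k)%:E)); last first.
  move=> k _; etransitivity; first exact: (prob_single i k mW fW).
  by rewrite /poisson_pmf mulr_gt0.
have r0 : 0 < m * area (window K.+1 : set pt) by rewrite mulr_gt0.
have h1 : poisson_prob (m * area (window K.+1)) 0 setT = 1%E :=
  @probability_setT _ _ R (poisson_prob (m * area (window K.+1)) 0).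
rewrite -h1 /poisson_prob r0 (eq_eseriesl (Q := xpredT)); last by move=> k; rewrite in_setT.
by rewrite nneseries_esumT// => k; rewrite lee_fin poisson_pmf_ge0.
Qed.

(** The first part is the failure of local finiteness; the second is the absence of any macro
    station, since the windows exhaust the plane. *)
Definition bad : set Omega :=
  (\bigcup_K \bigcup_(i in [set: 'I_3]) ~` (\bigcup_k [set w |
     npts (nth (fun _ => set0) [:: Phi true; Phi false; U] i w) (window K.+1) = k%:R%:E]))
  `|` \bigcap_K [set w | npts (Phi true w) (window K) = 0%E].

Lemma bad_null : measurable bad /\ P bad = 0%E.
Proof.
have mN (i : 'I_3) K k : measurable [set w |
    npts (nth (fun _ => set0) [:: Phi true; Phi false; U] i w) (window K) = k%:R%:E].
  have h := hPPP.1 i _ (@measurable_window R K).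
  by have := h measurableT _ (emeasurable_set1 k%:R%:E); rewrite setTI.
have mU (i : 'I_3) K : measurable (\bigcup_k [set w |
    npts (nth (fun _ => set0) [:: Phi true; Phi false; U] i w) (window K.+1) = k%:R%:E]).
  by apply: bigcup_measurable => k _; exact: mN.
have m1 : measurable (\bigcup_K \bigcup_(i in [set: 'I_3]) ~` (\bigcup_k [set w |
     npts (nth (fun _ => set0) [:: Phi true; Phi false; U] i w) (window K.+1) = k%:R%:E])).
  apply: bigcup_measurable => K _; apply: fin_bigcup_measurable => // i _.
  exact: measurableC.
have m2 : measurable (\bigcap_K [set w | npts (Phi true w) (window K) = 0%E]).
  apply: bigcapT_measurable => K.
  by apply: measurable_npts_station; exact: measurable_window.
have m3 : measurable bad by exact: measurableU.
split => //; apply: measure_negligible => //; apply: negligibleU.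
  apply: negligible_bigcup => K.
  have -> : \bigcup_(i in [set: 'I_3]) ~` (\bigcup_k [set w |
     npts (nth (fun _ => set0) [:: Phi true; Phi false; U] i w) (window K.+1) = k%:R%:E]) =
    \bigcup_i (if (i < 3)%N then ~` (\bigcup_k [set w |
     npts (nth (fun _ => set0) [:: Phi true; Phi false; U] i w) (window K.+1) = k%:R%:E])
       else set0).
    apply/seteqP; split => w [i _ h]; first by exists (val i) => //; rewrite ltn_ord.
    by case: ifPn h => // i3 h; exists (Ordinal i3).
  apply: negligible_bigcup => i; case: ifPn => [i3|_]; last exact: negligible_set0.
  apply/negligibleP; first by apply: measurableC; exact: (mU (Ordinal i3)).
  apply: (etrans (probability_setC P (mU (Ordinal i3) K))).
  by rewrite [X in (1 - X)%E](npts_fin_num_prob (Ordinal i3)) subee.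
apply/negligibleP => //; apply/eqP; rewrite eq_le measure_ge0 andbT.
(* The absence of macro stations is bounded by the void probability of one window, whose mean count
   grows like $K^2$. *)
have bound K : (P (\bigcap_K [set w | npts (Phi true w) (window K) = 0%E]) <=
    (expR (- (l true * (2 * K%:R) ^+ 2)))%:E)%E.
  have mW := @measurable_window R K.
  have -> : expR (- (l true * (2 * K%:R) ^+ 2)) = poisson_law (l true * area (window K : set pt)) 0.
    by rewrite poisson_law0 /area leb2_window.
  rewrite -(prob_single (@Ordinal 3 0 isT))//; last by rewrite leb2_window ltry.
  apply: le_measure; [by apply/mem_set; exact: m2|
    by apply/mem_set; exact: (mN (@Ordinal 3 0 isT) K 0%N)|by move=> w h; exact: (h K I)].
pose p := P (\bigcap_K [set w | npts (Phi true w) (window K) = 0%E]).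
suff : (p <= 0)%E by [].
have {}bound K : (p <= (expR (- (l true * (2 * K%:R) ^+ 2)))%:E)%E := bound K.
have pfin : p \is a fin_num by rewrite /p fin_num_measure//; exact: m2.
rewrite -(fineK pfin) lee_fin leNgt; apply/negP => p0.
(* With $K$ above $1/(p\,l)$, where $p$ is the probability in question and $l$ the macro intensity,
   the bound $p\,(1+l(2K)^2)\le 1$ obtained from $e^x\ge 1+x$ fails. *)
pose K := (Num.truncn ((fine p * l true)^-1)).+1.
have hK : (fine p * l true)^-1 < K%:R by exact: truncnS_gt.
have := bound K; rewrite -(fineK pfin) lee_fin => h.
have pl0 : 0 < fine p * l true by rewrite mulr_gt0.
have K1 : 1 <= K%:R :> R by rewrite ler1n.
have e1 := expR_ge1Dx (l true * (2 * K%:R) ^+ 2).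
have e2 : expR (- (l true * (2 * K%:R) ^+ 2)) * expR (l true * (2 * K%:R) ^+ 2) = 1.
  by rewrite -expRD addNr expR0.
have e3 : fine p * (1 + l true * (2 * K%:R) ^+ 2) <= 1.
  rewrite -[leRHS]e2; apply: (ler_pM _ _ h e1); first exact: ltW.
  by rewrite addr_ge0// mulr_ge0// ?sqr_ge0// ltW.
have e4 : 1 < fine p * l true * K%:R.
  by rewrite mulrC -ltr_pdivrMr// mul1r.
have e5 : K%:R <= (2 * K%:R) ^+ 2 :> R by nra.
have : fine p * l true * K%:R <= fine p * l true * (2 * K%:R) ^+ 2 by rewrite ler_pM2l.
have := ltW p0; lra.
Qed.

Lemma good_event w : ~ bad w ->
  (forall K, [/\ forall b, finite_set (Phi b w `&` window K) & finite_set (U w `&` window K)]) /\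
  exists b X, Phi b w X.
Proof.
move=> /not_orP[n1 n2].
have F (i : 'I_3) K : finite_set (nth (fun _ => set0) [:: Phi true; Phi false; U] i w `&`
    window K).
  apply: (@sub_finite_set _ _ (nth (fun _ => set0) [:: Phi true; Phi false; U] i w `&`
      window K.+1)); first by apply: setIS; exact: window_le.
  have [k _ /npts_fin//] : (\bigcup_k [set w |
     npts (nth (fun _ => set0) [:: Phi true; Phi false; U] i w) (window K.+1) = k%:R%:E]) w.
  by apply: contrapT => h; apply: n1; exists K => //; exists i.
split.
  move=> K; split; last exact: (F user_idx).
  by move=> b; have := F (station_idx b) K; case: b.
apply: contrapT => h; apply: n2 => K _; apply/npts0P; apply/seteqP; split => // X [SX _].
by apply: h; exists true, X.
Qed.

End poisson_points.

(** * Expectations of the cell counts *)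

Section expectations.
Context (R : realType) d (Omega : measurableType d) (P : probability Omega R).
Variables (beta : R) (pw : bool -> R).
Variables (Phi : bool -> Omega -> set (R * R)) (U : Omega -> set (R * R)).
Variables (l : bool -> R) (lU : R).
Local Notation pt := (R1 R * R1 R)%type.
Local Notation Sq := (@unit_square R).
Hypothesis beta_gt0 : 0 < beta.
Hypothesis pw_gt0 : forall b, 0 < pw b.
Hypothesis l_gt0 : forall b, 0 < l b.
Hypothesis lU_gt0 : 0 < lU.
Hypothesis hPPP : indep_hPPPs P
  (fun i : 'I_3 => nth (fun _ => set0) [:: Phi true; Phi false; U] i)
  (fun i : 'I_3 => nth 0 [:: l true; l false; lU] i).

Section event_probability.
Variables (K n : nat) (mask : triples K n -> bool) (V1 V2 : bool -> triples K n -> set pt).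
Hypothesis mV1 : forall b t, measurable (V1 b t).
Hypothesis mV2 : forall b t, measurable (V2 b t).
Hypothesis fV1 : forall b t, (leb2 (V1 b t) < +oo)%E.
Hypothesis fV2 : forall b t, (leb2 (V2 b t) < +oo)%E.
Hypothesis dV1 : forall b t, cell t.1 `&` V1 b t = set0.
Hypothesis mask_neq : forall t, mask t -> t.2.1 != t.2.2.

Let ev (j : bool * triples K n + cells K n) : set Omega :=
  [set w | event (fun b => Phi b w) (U w) mask V1 V2 j].

Lemma measurable_cellI (c : cells K n) : measurable (cell c `&` Sq : set pt).
Proof. by apply: measurableI; [exact: measurable_cell|exact: measurable_unit_square]. Qed.

Let measurable_ev j : measurable (ev j).
Proof.
case: j => [[b t]|c]; last first.
  by apply: (measurable_npts_user hPPP); exact: measurable_cellI.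
rewrite /ev /event; have [mt|mt] := boolP (mask t); last first.
  rewrite [X in measurable X](_ : _ = set0)//.
  by apply/seteqP; split => // w /= [].
rewrite [X in measurable X](_ : _ =
    [set w | npts (Phi b w) (cell t.1) = 1%E] `&` [set w | npts (Phi b w) (V1 b t) = 0%E] `&`
    [set w | npts (Phi (~~ b) w) (V2 b t) = 0%E] `&`
    [set w | npts (U w) (cell t.2.1 `&` Sq) = 1%E] `&` [set w | npts (U w) (cell t.2.2) = 1%E]).
  apply: measurableI; last by apply: (measurable_npts_user hPPP); exact: measurable_cell.
  apply: measurableI; last by apply: (measurable_npts_user hPPP); exact: measurable_cellI.
  apply: measurableI; last by apply: (measurable_npts_station hPPP); exact: mV2.
  apply: measurableI; last by apply: (measurable_npts_station hPPP); exact: mV1.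
  by apply: (measurable_npts_station hPPP); exact: measurable_cell.
by apply/seteqP; split => w /=; [move=> [_ []]|move=> [[[[]]]]].
Qed.

Definition event_prob (j : bool * triples K n + cells K n) : R :=
  match j with
  | inr c => poisson_law (lU * area (cell c `&` Sq)) 1
  | inl (b, t) => if mask t then
      poisson_law (l b * area (cell t.1)) 1 * poisson_law (l b * area (V1 b t)) 0 *
      poisson_law (l (~~ b) * area (V2 b t)) 0 * poisson_law (lU * area (cell t.2.1 `&` Sq)) 1 *
      poisson_law (lU * area (cell t.2.2)) 1
    else 0
  end.

Lemma leb2_cell_lty (c : cells K n) : (leb2 (cell c : set pt) < +oo)%E.
Proof. by rewrite leb2_cell ltry. Qed.

Let P_ev j : P (ev j) = (event_prob j)%:E.
Proof.
case: j => [[b t]|c]; last first.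
  by rewrite -(prob_single hPPP user_idx)//; [exact: measurable_cellI|exact: leb2_cellI_lty].
rewrite /event_prob; have [mt|mt] := boolP (mask t); last first.
  rewrite (_ : ev _ = set0) ?measure0//.
  by apply/seteqP; split => // w; rewrite /ev /= (negbTE mt) => -[].
have disj : (cell t.2.1 `&` Sq) `&` cell t.2.2 = set0 :> set pt.
  by rewrite setIAC cell_disjoint ?set0I// mask_neq.
rewrite -(prob_joint hPPP b (@measurable_cell R K n t.1) (leb2_cell_lty t.1)
  (mV1 b t) (fV1 b t) (mV2 b t) (fV2 b t) (measurable_cellI t.2.1) (@leb2_cellI_lty R K n t.2.1)
  (@measurable_cell R K n t.2.2) (leb2_cell_lty t.2.2) (dV1 b t) disj).
by congr (P _); apply/seteqP; split => w; rewrite /ev /= mt => // -[].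
Qed.

Lemma measurable_event_count : measurable_fun setT
  (fun w => \sum_j (\1_(event (fun b => Phi b w) (U w) mask V1 V2) j : R)%:E)%E.
Proof.
apply: emeasurable_sum => j; apply/measurable_EFinP.
rewrite [X in measurable_fun _ X](_ : _ = \1_(ev j)); first exact: measurable_indic.
apply/funext => w; rewrite !indicE.
by congr (nat_of_bool _)%:R; apply/idP/idP => /set_mem h; apply/mem_set.
Qed.

Lemma integral_event_count :
  (\int[P]_w \sum_j (\1_(event (fun b => Phi b w) (U w) mask V1 V2) j : R)%:E =
   (\sum_(c : cells K n) event_prob (inr c) +
    (\sum_(t : triples K n) event_prob (inl (true, t)) +
     \sum_(t : triples K n) event_prob (inl (false, t))))%:E)%E.
Proof.
have E w j : \1_(event (fun b => Phi b w) (U w) mask V1 V2) j = \1_(ev j) w :> R.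
  by rewrite !indicE; congr (nat_of_bool _)%:R; apply/idP/idP => /set_mem h; apply/mem_set.
rewrite (eq_integral (fun w => \sum_j (\1_(ev j) w : R)%:E)%E); last first.
  by move=> w _; apply: eq_bigr => j _; rewrite E.
rewrite ge0_integral_sum//; last first.
  by move=> j; apply/measurable_EFinP; exact: measurable_indic.
rewrite (eq_bigr (fun j => (event_prob j)%:E)); last first.
  by move=> j _; rewrite integral_indic// setIT; exact: P_ev.
rewrite sumEFin big_sumType/= addrC; congr ((_ + _)%:E).
rewrite (eq_bigr (fun p : bool * triples K n => event_prob (inl (p.1, p.2)))); last by case.
by rewrite -(pair_bigA _ (fun b t => event_prob (inl (b, t))))/= big_bool.
Qed.

End event_probability.

Lemma area_cell K n (c : cells K n) : area (cell c : set pt) = mesh R n ^+ 2.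
Proof. by rewrite /area leb2_cell. Qed.

Lemma sum_area_cellI K n : \sum_(c : cells K n) area (cell c `&` Sq) = area (window K `&` Sq).
Proof.
have -> : window K `&` Sq = \bigcup_(c in [set: cells K n]) (cell c `&` Sq).
  apply/seteqP; split => z; first by move=> [/(cell_cover n)[c cz] Sz]; exists c.
  by move=> [c _ [cz Sz]]; split => //; exact: cell_sub_window cz.
rewrite /area (_ : leb2 _ = \sum_(c : cells K n) leb2 (cell c `&` Sq))%E; last first.
  rewrite (measure_fin_bigcup (@leb2 R) (@finite_finset _ _)); last 2 first.
  - move=> c c' _ _ [z [[cz _] [c'z _]]]; exact: cell_inj cz c'z.
  - by move=> c _; exact: measurable_cellI.
  have -> : [set: cells K n] = [set` index_enum (cells K n)].
    by apply/seteqP; split => // j _; rewrite /= mem_index_enum.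
  by rewrite -fsbig_seq ?index_enum_uniq.
rewrite (eq_bigr (fun c => (area (cell c `&` Sq))%:E)); last first.
  by move=> c _; rewrite areaE// leb2_cellI_lty.
by rewrite sumEFin.
Qed.

(** For $K=1$ the half-open window misses two sides of the closed square, hence the threshold 2. *)
Lemma window_unit_square K : (2 <= K)%N -> window K `&` Sq = Sq.
Proof.
move=> K2; apply/setIidPr => z [/andP[h1 h2] /andP[h3 h4]].
have : 2 <= K%:R :> R by rewrite ler_nat.
by move=> k2; split; rewrite /= in_itv/=; apply/andP; split; lra.
Qed.

Lemma area_unit_square : area Sq = 1.
Proof. by rewrite /area leb2_unit_square. Qed.

Lemma area_sub (A B : set pt) : measurable A -> measurable B -> (leb2 B < +oo)%E ->
  A `<=` B -> area A <= area B.
Proof.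
move=> mA mB fB AB; rewrite -lee_fin -!areaE//; last exact: leb2_sub_lty AB fB.
by apply: le_measure; rewrite ?inE.
Qed.

Lemma measurable_cells_of K n (t : triples K n) : measurable (cells_of t : set pt).
Proof. by apply: measurableU; [apply: measurableU|]; exact: measurable_cell. Qed.

(** Three cells have total area at most $3h$, where $h$ is the area of one; this is the origin of
    the constant 3 in the upper bounds. *)
Lemma area_cells_of K n (t : triples K n) (V : set pt) : measurable V -> (leb2 V < +oo)%E ->
  area V <= area (V `\` cells_of t) + 3 * mesh R n ^+ 2.
Proof.
move=> mV fV; have mC := measurable_cells_of t.
have mD : measurable (V `\` cells_of t) by exact: measurableD.
have fD : (leb2 (V `\` cells_of t) < +oo)%E.
  by apply: leb2_sub_lty fV => //; exact: subDsetl.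
rewrite -lee_fin EFinD -!areaE//.
have mc (c : cells K n) := @measurable_cell R K n c.
have hC : (leb2 (cells_of t) <= (3 * mesh R n ^+ 2)%:E)%E.
  apply: (@le_trans _ _ (leb2 (cell t.1) + leb2 (cell t.2.1) + leb2 (cell t.2.2))%E).
    apply: (le_trans (measureU2 (@leb2 R) (measurableU _ _ (mc _) (mc _)) (mc _))).
    by apply: leeD => //; exact: (measureU2 (@leb2 R) (mc _) (mc _)).
  by rewrite !leb2_cell -!EFinD lee_fin; lra.
apply: (@le_trans _ _ (leb2 (V `\` cells_of t) + leb2 (cells_of t))%E); last exact: leeD.
apply: (@le_trans _ _ (leb2 ((V `\` cells_of t) `|` cells_of t))).
  apply: le_measure; rewrite ?inE//; first exact: measurableU.
  by move=> z Vz; have [?|?] := pselect (cells_of t z); [right|left].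
exact: (measureU2 (@leb2 R) mD mC).
Qed.

(** The intensity of triples made of a station of tier [b] and two users: what remains of the three
    mean counts in a brick once its volume is taken out. *)
Definition kappa b : R := l b * lU ^+ 2.

Lemma kappa_gt0 b : 0 < kappa b.
Proof. by rewrite mulr_gt0// exprn_gt0. Qed.

Definition lower_sum b K n : R := \sum_(t : triples K n)
  masked (@distinct_cells K n) (contact_cell (l b) (l (~~ b)) (reach beta pw b (~~ b))
    (slack beta pw n b b) (slack beta pw n b (~~ b))) t * brick_area t.

(** The mask of [upper_event] is dropped here: the terms are nonnegative, so the sum only grows. *)
Definition upper_sum b K n : R := \sum_(t : triples K n)
  masked (fun=> true) (contact_cell (l b) (l (~~ b)) (reach beta pw b (~~ b))
    (- slack beta pw n b b) (- slack beta pw n b (~~ b))) t * brick_area t.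

Definition lower_count_fun K n w : \bar R := (\sum_j
  (\1_(lower_event beta pw (fun b => Phi b w) (U w) (K := K) (n := n)) j)%:E)%E.

Definition upper_count_fun K n w : \bar R := (\sum_j
  (\1_(upper_event beta pw (fun b => Phi b w) (U w) (K := K) (n := n)) j)%:E)%E.

Lemma brick_area_ge0 K n (t : triples K n) : 0 <= brick_area t :> R.
Proof. by rewrite mulr_ge0 ?area_ge0// mulr_ge0 ?area_ge0. Qed.

Lemma expR_le1 (x : R) : 0 <= x -> expR (- x) <= 1.
Proof. by move=> x0; rewrite -[leRHS]expR0 ler_expR oppr_le0. Qed.

Lemma ler_prod5 (c x1 x2 x3 x4 x5 y1 y2 y3 y4 y5 : R) : 0 <= c ->
  0 <= x1 <= y1 -> 0 <= x2 <= y2 -> 0 <= x3 <= y3 -> 0 <= x4 <= y4 -> 0 <= x5 <= y5 ->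
  c * (x1 * x2 * x3 * x4 * x5) <= c * (y1 * y2 * y3 * y4 * y5).
Proof.
move=> c0 /andP[? ?] /andP[? ?] /andP[? ?] /andP[? ?] /andP[? ?].
by apply: ler_wpM2l => //; do 4 (apply: ler_pM => //; rewrite ?mulr_ge0//).
Qed.

Lemma regroup_events (A L h a x1 x2 x3 x4 x5 : R) :
  A * L ^+ 2 * (h * (a * h)) * (x1 * x2 * x3 * x4 * x5) =
  A * h * x1 * x2 * x3 * (L * a * x4) * (L * h * x5).
Proof. ring. Qed.

Lemma regroup_lower (A L h a x1 x2 x3 x4 x5 : R) :
  A * L ^+ 2 * (x1 * x4 * x5) * (x2 * x3 * (h * (a * h))) =
  A * h * x1 * x2 * x3 * (L * a * x4) * (L * h * x5).
Proof. ring. Qed.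

Lemma regroup_upper (A L h a e2 e3 x2 x3 : R) :
  A * L ^+ 2 * (e2 * e3) * (x2 * x3 * (h * (a * h))) =
  A * h * 1 * (e2 * x2) * (e3 * x3) * (L * a * 1) * (L * h * 1).
Proof. ring. Qed.

(** The exponentials of the three single counts are kept as $e^{-(A+2L)h}$, using $a\le h$; cutting
    a cell out of the void region only raises its void probability, whence $v_1\le w_1$. *)
Lemma lower_term (A B L h a h1 h2 v1 v2 w1 : R) : 0 < A -> 0 < B -> 0 < L ->
  0 <= h -> 0 <= a -> h1 = h -> h2 = h -> a <= h -> v1 <= w1 ->
  A * L ^+ 2 * expR (- ((A + 2 * L) * h)) *
    (expR (- A * w1) * expR (- B * v2) * (h1 * (a * h2))) <=
  poisson_law (A * h1) 1 * poisson_law (A * v1) 0 * poisson_law (B * v2) 0 *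
    poisson_law (L * a) 1 * poisson_law (L * h2) 1.
Proof.
move=> A0 B0 L0 h0 a0 -> -> ah vw; rewrite !poisson_law1 !poisson_law0 !mulNr.
have -> : expR (- ((A + 2 * L) * h)) = expR (- (A * h)) * expR (- (L * h)) * expR (- (L * h)).
  by rewrite -!expRD; congr expR; ring.
have c0 : 0 <= A * L ^+ 2 * (h * (a * h)).
  apply: mulr_ge0; last by apply: mulr_ge0 => //; exact: mulr_ge0.
  by apply: mulr_ge0; [exact: ltW|apply: exprn_ge0; exact: ltW].
have F (x y c : R) : 0 < c -> x <= y -> 0 <= expR (- (c * y)) <= expR (- (c * x)).
  by move=> c0' xy; rewrite expR_ge0 ler_expR lerN2 ler_pM2l.
move: (ler_prod5 c0 (F _ _ _ A0 (lexx h)) (F _ _ _ A0 vw) (F _ _ _ B0 (lexx v2))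
  (F _ _ _ L0 ah) (F _ _ _ L0 (lexx h))).
by rewrite !regroup_events regroup_lower.
Qed.

(** The exponentials of the single counts are bounded by 1, and the area, at most $3h$, missing from
    each void region costs the factor $e^{3(A+B)h}$. *)
Lemma upper_term (A B L h a h1 h2 v1 v2 w1 w2 : R) : 0 < A -> 0 < B -> 0 < L ->
  0 <= h -> 0 <= a -> h1 = h -> h2 = h -> w1 <= v1 + 3 * h -> w2 <= v2 + 3 * h ->
  poisson_law (A * h1) 1 * poisson_law (A * v1) 0 * poisson_law (B * v2) 0 *
    poisson_law (L * a) 1 * poisson_law (L * h2) 1 <=
  A * L ^+ 2 * expR (3 * (A + B) * h) * (expR (- A * w1) * expR (- B * w2) * (h1 * (a * h2))).
Proof.
move=> A0 B0 L0 h0 a0 -> -> vw1 vw2; rewrite !poisson_law1 !poisson_law0 !mulNr.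
have -> : expR (3 * (A + B) * h) = expR (A * (3 * h)) * expR (B * (3 * h)).
  by rewrite -expRD; congr expR; ring.
have c0 : 0 <= A * L ^+ 2 * (h * (a * h)).
  apply: mulr_ge0; last by apply: mulr_ge0 => //; exact: mulr_ge0.
  by apply: mulr_ge0; [exact: ltW|apply: exprn_ge0; exact: ltW].
have E (x c : R) : 0 < c -> 0 <= x -> 0 <= expR (- (c * x)) <= 1.
  by move=> c0' x0; rewrite expR_ge0 expR_le1// mulr_ge0// ltW.
have F (x y c : R) : 0 < c -> y <= x + 3 * h ->
    0 <= expR (- (c * x)) <= expR (c * (3 * h)) * expR (- (c * y)).
  move=> c0' xy; rewrite expR_ge0 -expRD ler_expR.
  by move: xy; rewrite -(ler_pM2l c0') mulrDr; lra.
move: (ler_prod5 c0 (E _ _ A0 h0) (F _ _ _ A0 vw1) (F _ _ _ B0 vw2) (E _ _ L0 a0) (E _ _ L0 h0)).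
by rewrite !regroup_events regroup_upper.
Qed.

Lemma area_outer_cell b K n (t : triples K n) :
  [/\ measurable (outer beta pw b b t `\` cell t.1 : set pt),
      (leb2 (outer beta pw b b t `\` cell t.1) < +oo)%E &
      area (outer beta pw b b t `\` cell t.1) <= area (outer beta pw b b t)].
Proof.
have mo : measurable (outer beta pw b b t : set pt) by exact: measurable_disc_pair.
have mD : measurable (outer beta pw b b t `\` cell t.1 : set pt).
  by apply: measurableD => //; exact: measurable_cell.
have fo : (leb2 (outer beta pw b b t) < +oo)%E by exact: leb2_disc_pair_lty.
split => //; first by apply: leb2_sub_lty fo => //; exact: subDsetl.
by apply: area_sub => //; exact: subDsetl.
Qed.

Lemma inner_cells b b' K n (t : triples K n) :
  measurable (inner beta pw b b' t `\` cells_of t : set pt) /\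
  (leb2 (inner beta pw b b' t `\` cells_of t) < +oo)%E.
Proof.
have mi : measurable (inner beta pw b b' t : set pt) by exact: measurable_disc_pair.
have mD : measurable (inner beta pw b b' t `\` cells_of t : set pt).
  by apply: measurableD => //; exact: measurable_cells_of.
have fi : (leb2 (inner beta pw b b' t) < +oo)%E by exact: leb2_disc_pair_lty.
by split => //; apply: leb2_sub_lty fi => //; exact: subDsetl.
Qed.

Lemma lower_expectation K n : (2 <= K)%N ->
  measurable_fun setT (lower_count_fun K n) /\
  ((lU * expR (- (lU * mesh R n ^+ 2)) +
    (kappa true * expR (- ((l true + 2 * lU) * mesh R n ^+ 2)) * lower_sum true K n +
     kappa false * expR (- ((l false + 2 * lU) * mesh R n ^+ 2)) * lower_sum false K n))%:E
   <= \int[P]_w lower_count_fun K n w)%E.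
Proof.
move=> K2.
have mV1 b (t : triples K n) : measurable (outer beta pw b b t `\` cell t.1 : set pt).
  by case: (area_outer_cell b t).
have fV1 b (t : triples K n) : (leb2 (outer beta pw b b t `\` cell t.1) < +oo)%E.
  by case: (area_outer_cell b t).
have mV2 b (t : triples K n) : measurable (outer beta pw b (~~ b) t : set pt).
  exact: measurable_disc_pair.
have fV2 b (t : triples K n) : (leb2 (outer beta pw b (~~ b) t) < +oo)%E.
  exact: leb2_disc_pair_lty.
have dV1 b (t : triples K n) : cell t.1 `&` (outer beta pw b b t `\` cell t.1) = set0.
  by rewrite setDE setICA setICr setI0.
have mk (t : triples K n) : distinct_cells t -> t.2.1 != t.2.2 by case/and3P.
split; first exact: (measurable_event_count _ mV1 mV2).
rewrite /lower_count_fun (integral_event_count mV1 mV2 fV1 fV2 dV1 mk) lee_fin.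
have h0 : 0 <= mesh R n ^+ 2 by rewrite sqr_ge0.
have hc (c : cells K n) : area (cell c `&` Sq) <= mesh R n ^+ 2.
  rewrite -(area_cell c); apply: area_sub; [exact: measurable_cellI|exact: measurable_cell|
    exact: leb2_cell_lty|exact: subIsetl].
apply: lerD.
  (* The cells of the window cover the whole unit square, so the diagonal events see its full
     area. *)
  have S1 : \sum_(c : cells K n) area (cell c `&` Sq) = 1.
    by rewrite sum_area_cellI window_unit_square// area_unit_square.
  rewrite -[X in X <= _]mulr1 -S1 mulr_sumr; apply: ler_sum => c _.
  rewrite /event_prob poisson_law1 mulrAC ler_wpM2l//.
    by rewrite mulr_ge0 ?area_ge0 ?(ltW lU_gt0).
  by rewrite ler_expR lerN2 ler_pM2l.
have term b : kappa b * expR (- ((l b + 2 * lU) * mesh R n ^+ 2)) * lower_sum b K n <=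
    \sum_(t : triples K n) event_prob (@distinct_cells K n)
      (fun b t => outer beta pw b b t `\` cell t.1) (fun b t => outer beta pw b (~~ b) t)
      (inl (b, t)).
  rewrite /lower_sum mulr_sumr; apply: ler_sum => t _; rewrite /masked /event_prob.
  case: ifP => _; last by rewrite mul0r mulr0.
  have hV : area (outer beta pw b b t `\` cell t.1) <= area (disc_pair 1 (slack beta pw n b b)
      (corner t.1) (corner t.2.1) (corner t.2.2)).
    have -> : disc_pair 1 (slack beta pw n b b) (corner t.1) (corner t.2.1) (corner t.2.2) =
        outer beta pw b b t by rewrite /outer reach_id.
    by case: (area_outer_cell b t).
  exact: (lower_term (area (outer beta pw b (~~ b) t)) (l_gt0 b) (l_gt0 (~~ b)) lU_gt0 h0 (area_ge0 _)
    (area_cell t.1) (area_cell t.2.2) (hc t.2.1) hV).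
by apply: lerD; exact: term.
Qed.

Lemma upper_expectation K n :
  measurable_fun setT (upper_count_fun K n) /\
  (\int[P]_w upper_count_fun K n w <=
   (lU + (kappa true * expR (3 * (l true + l false) * mesh R n ^+ 2) * upper_sum true K n +
     kappa false * expR (3 * (l true + l false) * mesh R n ^+ 2) * upper_sum false K n))%:E)%E.
Proof.
have mV1 b (t : triples K n) : measurable (inner beta pw b b t `\` cells_of t : set pt).
  exact: (inner_cells b b t).1.
have fV1 b (t : triples K n) : (leb2 (inner beta pw b b t `\` cells_of t) < +oo)%E.
  exact: (inner_cells b b t).2.
have mV2 b (t : triples K n) : measurable (inner beta pw b (~~ b) t `\` cells_of t : set pt).
  exact: (inner_cells b (~~ b) t).1.
have fV2 b (t : triples K n) : (leb2 (inner beta pw b (~~ b) t `\` cells_of t) < +oo)%E.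
  exact: (inner_cells b (~~ b) t).2.
have dV1 b (t : triples K n) : cell t.1 `&` (inner beta pw b b t `\` cells_of t) = set0.
  by apply/seteqP; split => // z [tz [_ []]]; left; left.
have mk (t : triples K n) : t.2.1 != t.2.2 -> t.2.1 != t.2.2 by [].
split; first exact: (measurable_event_count _ mV1 mV2).
rewrite /upper_count_fun (integral_event_count mV1 mV2 fV1 fV2 dV1 mk) lee_fin.
have h0 : 0 <= mesh R n ^+ 2 by rewrite sqr_ge0.
apply: lerD.
  apply: (@le_trans _ _ (\sum_(c : cells K n) lU * area (cell c `&` Sq))).
    apply: ler_sum => c _; rewrite /event_prob poisson_law1.
    by rewrite ler_piMr ?mulr_ge0 ?area_ge0 ?expR_le1 ?mulr_ge0 ?area_ge0 ?(ltW lU_gt0).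
  rewrite -mulr_sumr sum_area_cellI ler_piMr ?(ltW lU_gt0)// -area_unit_square.
  apply: area_sub; [|exact: measurable_unit_square|by rewrite leb2_unit_square ltry|exact: subIsetr].
  by apply: measurableI; [exact: measurable_window|exact: measurable_unit_square].
have term b : \sum_(t : triples K n) event_prob (fun t : triples K n => t.2.1 != t.2.2)
      (fun b t => inner beta pw b b t `\` cells_of t)
      (fun b t => inner beta pw b (~~ b) t `\` cells_of t) (inl (b, t)) <=
    kappa b * expR (3 * (l true + l false) * mesh R n ^+ 2) * upper_sum b K n.
  have -> : l true + l false = l b + l (~~ b) by case: b; rewrite // addrC.
  rewrite /upper_sum mulr_sumr; apply: ler_sum => t _; rewrite /masked /event_prob.
  have lb := l_gt0 b; have lb' := l_gt0 (~~ b).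
  case: ifP => _; last first.
    apply: mulr_ge0; first by rewrite mulr_ge0 ?expR_ge0 ?(ltW (kappa_gt0 b)).
    by rewrite mulr_ge0 ?contact_cell_ge0 ?brick_area_ge0.
  have hV := area_cells_of t (measurable_disc_pair _ _ _ _ _)
    (leb2_disc_pair_lty (reach beta pw b b) (- slack beta pw n b b) (corner t.1)
      (corner t.2.1) (corner t.2.2)).
  rewrite {1}reach_id// in hV.
  have hV' := area_cells_of t (measurable_disc_pair _ _ _ _ _)
    (leb2_disc_pair_lty (reach beta pw b (~~ b)) (- slack beta pw n b (~~ b)) (corner t.1)
      (corner t.2.1) (corner t.2.2)).
  exact: (upper_term (l_gt0 b) (l_gt0 (~~ b)) lU_gt0 h0 (area_ge0 _)
    (area_cell t.1) (area_cell t.2.2) hV hV').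
by apply: lerD; [exact: (term true)|exact: (term false)].
Qed.

End expectations.

(** * The mean number of served pairs *)

Section mean_served_pairs.
Context (R : realType) d (Omega : measurableType d) (P : probability Omega R).
Variables (beta : R) (pw : bool -> R).
Variables (Phi : bool -> Omega -> set (R * R)) (U : Omega -> set (R * R)).
Variables (l : bool -> R) (lU : R).
Local Notation pt := (R1 R * R1 R)%type.
Local Notation Sq := (@unit_square R).
Hypothesis beta_gt0 : 0 < beta.
Hypothesis pw_gt0 : forall b, 0 < pw b.
Hypothesis l_gt0 : forall b, 0 < l b.
Hypothesis lU_gt0 : 0 < lU.
Hypothesis hPPP : indep_hPPPs P
  (fun i : 'I_3 => nth (fun _ => set0) [:: Phi true; Phi false; U] i)
  (fun i : 'I_3 => nth 0 [:: l true; l false; lU] i).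

Let pairs w : \bar R :=
  (\esum_(p in served_pairs beta pw (fun b => Phi b w) (U w)) 1)%E.

Let pairs_ge0 w : (0 <= pairs w)%E.
Proof. by apply: esum_ge0 => *; exact: lee01. Qed.

(** Finitely many points in a window have a positive minimal distance, while two points of one cell
    are within $4\,$[mesh] of each other, each being within $2\,$[mesh] of the corner. *)
Lemma near_separated w K : ~ bad Phi U w -> \forall n \near \oo,
  forall S, S = U w \/ (exists b, S = Phi b w) -> forall x y (c : cells K n),
    S x -> S y -> cell c x -> cell c y -> x = y.
Proof.
move=> /good_event[fin _].
have sep (S : set (R * R)) : finite_set (S `&` window K) -> \forall n \near \oo,
    forall q : (R * R) * (R * R),
      ((S `&` window K) `*` (S `&` window K)) q -> dist2 q.1 q.2 <= 4 * mesh R n -> q.1 = q.2.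
  move=> fS; apply: near_all_finite => [|[x y] _ /=]; first exact: finite_setX.
  have [->|/eqP xy] := eqVneq x y; first exact: nearW.
  have d0 := dist2_gt0 xy.
  have m4 : 4 * mesh R n @[n --> \oo] --> (0 : R).
    by rewrite -[X in _ --> X](mulr0 4); apply: cvgM; [exact: cvg_cst|exact: cvg_mesh].
  near=> n => h; exfalso; move: h; apply/negP; rewrite -ltNge.
  by near: n; exact: (cvgr_lt _ m4).
have s1 := sep _ (fin K).2; have s2 := sep _ ((fin K).1 true); have s3 := sep _ ((fin K).1 false).
near=> n => S HS x y c Sx Sy cx cy.
have wx := cell_sub_window cx; have wy := cell_sub_window cy.
have dxy : dist2 x y <= 4 * mesh R n.
  have := dist2_triangle (corner c) x y; have := dist2_corner cx; have := dist2_corner cy.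
  by rewrite (dist2C (corner c) y); lra.
have fin1 : forall q : (R * R) * (R * R), ((S `&` window K) `*` (S `&` window K)) q ->
    dist2 q.1 q.2 <= 4 * mesh R n -> q.1 = q.2.
  by case: HS => [->|[[] ->]]; near: n.
by apply: (fin1 (x, y)).
Unshelve. all: by end_near. Qed.

(** The sum is the supremum over finite sets [F] of pairs. Such an [F], with one serving station for
    each pair, lies in a window for large [K], and a mesh fine enough for that window then separates
    the points; hence the order of the two lower limits. *)
Lemma pairs_le_liminf w : ~ bad Phi U w ->
  (pairs w <= limn_einf (fun K => limn_einf (fun n => upper_count_fun beta pw Phi U K n w)))%E.
Proof.
move=> gw; apply: ge_ereal_sup => _ [F [finF FA] <-].
rewrite -(esum_fset (a := fun=> 1%E) finF) => [|x _]; last exact: lee01.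
apply: le_limn_einf.
have [N _ hN] : \forall K \near \oo, forall p, F p -> [/\ window K p.1, window K p.2 & exists b X,
    [/\ Phi b w X, window K X, covers beta pw (fun b => Phi b w) b X p.1 &
      covers beta pw (fun b => Phi b w) b X p.2]].
  apply: near_all_finite => // p /FA[_ _ _ [b [X [SX c1 c2]]]].
  have [K1 h1] := window_exhaust p.1; have [K2 h2] := window_exhaust p.2.
  have [K3 h3] := window_exhaust X.
  exists (K1 + K2 + K3)%N => // K /= hK; split; [by apply: h1; lia|by apply: h2; lia|].
  by exists b, X; split => //; apply: h3; lia.
exists N => // K NK; apply: le_limn_einf.
have [M _ hM] := near_separated K gw.
by exists M => // n Mn; apply: (upper_count beta_gt0 pw_gt0 (hM n Mn) FA (hN K NK)).
Qed.

Lemma lower_le_pairs K n w : ~ bad Phi U w -> (lower_count_fun beta pw Phi U K n w <= pairs w)%E.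
Proof.
move=> /good_event[fin ex]; apply: (lower_count beta_gt0 pw_gt0).
by apply: (exists_covering beta_gt0 pw_gt0) => // b K'; exact: (fin K').1.
Qed.

Let I b : \bar R := contact_integral (l b) (l (~~ b)) (reach beta pw b (~~ b)).
Let W K b : \bar R := window_integral K (l b) (l (~~ b)) (reach beta pw b (~~ b)).

Lemma window_integral_fin K b : W K b \is a fin_num.
Proof.
have W0 : (0 <= W K b)%E.
  by apply: integral_ge0 => q _; rewrite lee_fin mulr_ge0// contact_ge0.
rewrite ge0_fin_numE//; apply: (@le_lt_trans _ _ (leb6 (bricks K))); last exact: leb6_bricks_lty.
have -> : leb6 (bricks K) = (\int[@leb6 R]_q (\1_(bricks K) q)%:E)%E.
  by rewrite integral_indic ?setIT//; exact: measurable_bricks.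
have mB : measurable_fun setT (\1_(bricks K) : pt * (pt * pt) -> R).
  by apply: measurable_indic; exact: measurable_bricks.
apply: ge0_le_integral => //.
- by move=> q _; rewrite lee_fin mulr_ge0// contact_ge0.
- by apply/measurable_EFinP; apply: measurable_funM => //; exact: measurable_contact3.
- exact/measurable_EFinP.
- by move=> q _; rewrite lee_fin ler_piMr// contact_le1// ltW.
Qed.

Lemma cvg_slack b b' : slack beta pw n b b' @[n --> \oo] --> (0 : R).
Proof.
rewrite -[X in _ --> X](mulr0 (2 * reach beta pw b b' + 2)).
apply: cvgM; first exact: cvg_cst.
by rewrite -[X in _ --> X](mulr0 2); apply: cvgM; [exact: cvg_cst|exact: cvg_mesh].
Qed.

Lemma cvg_expR_mesh (c : R) : expR (c * mesh R n ^+ 2) @[n --> \oo] --> (1 : R).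
Proof.
rewrite -expR0; apply: (continuous_cvg _ (@continuous_expR R _)).
rewrite -[X in _ --> X](mulr0 c); apply: cvgM; first exact: cvg_cst.
rewrite -[X in _ --> X](mulr0 0); under eq_fun do rewrite expr2.
by apply: cvgM; exact: cvg_mesh.
Qed.

Lemma cvg_upper_sum b K : upper_sum beta pw l b K n @[n --> \oo] --> fine (W K b).
Proof.
suff h : (upper_sum beta pw l b K n)%:E @[n --> \oo] --> (fine (W K b))%:E.
  exact: (fine_cvg h).
rewrite (fineK (window_integral_fin K b)).
rewrite /W; have lb := ltW (l_gt0 b); have lb' := ltW (l_gt0 (~~ b)).
have h : - slack beta pw n b b @[n --> \oo] --> (0 : R) by rewrite -oppr0; apply: cvgN; exact: cvg_slack.
have h' : - slack beta pw n b (~~ b) @[n --> \oo] --> (0 : R).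
  by rewrite -oppr0; apply: cvgN; exact: cvg_slack.
have ht (q : pt * (pt * pt)) : ~ coincidences q ->
    \forall n \near \oo, forall t : triples K n, brick t q -> true.
  by move=> _; exact: nearW.
have := @cvg_integral_step R K _ _ (reach beta pw b (~~ b)) _ _ (fun n (t : triples K n) => true)
  lb lb' h h' ht.
apply: cvg_trans; apply: near_eq_cvg; near=> n; rewrite integral_step_fun//.
by move=> t; exact: contact_cell_ge0.
Unshelve. all: by end_near. Qed.

Lemma near_distinct K (q : pt * (pt * pt)) : ~ coincidences q ->
  \forall n \near \oo, forall t : triples K n, brick t q -> distinct_cells t.
Proof.
move=> /not_orP[/not_orP[/= n1 n2] n3].
have m4 : 4 * mesh R n @[n --> \oo] --> (0 : R).
  by rewrite -[X in _ --> X](mulr0 4); apply: cvgM; [exact: cvg_cst|exact: cvg_mesh].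
have sep (x y : pt) : x <> y -> \forall n \near \oo, forall c c' : cells K n,
    cell c x -> cell c' y -> c != c'.
  move=> /dist2_gt0 d0; near=> n => c c' cx cy; apply/eqP => e; subst c'.
  have : 4 * mesh R n < dist2 x y by near: n; exact: (cvgr_lt _ m4).
  have := dist2_triangle (corner c) x y; have := dist2_corner cx; have := dist2_corner cy.
  by rewrite (dist2C (corner c) y); lra.
have s1 := sep _ _ n1; have s2 := sep _ _ n2; have s3 := sep _ _ n3.
near=> n => t [t1 [[t2 _] t3]]; apply/and3P; split.
- by move: t1 t2; apply: (near s1 n).
- by move: t1 t3; apply: (near s2 n).
- by move: t2 t3; apply: (near s3 n).
Unshelve. all: by end_near. Qed.

Lemma cvg_lower_sum b K : lower_sum beta pw l b K n @[n --> \oo] --> fine (W K b).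
Proof.
suff h : (lower_sum beta pw l b K n)%:E @[n --> \oo] --> (fine (W K b))%:E.
  exact: (fine_cvg h).
rewrite (fineK (window_integral_fin K b)).
rewrite /W; have lb := ltW (l_gt0 b); have lb' := ltW (l_gt0 (~~ b)).
have ht (q : pt * (pt * pt)) : ~ coincidences q ->
    \forall n \near \oo, forall t : triples K n, brick t q -> true.
  by move=> _; exact: nearW.
have := @cvg_integral_step R K _ _ (reach beta pw b (~~ b)) _ _ (fun n => @distinct_cells K n)
  lb lb' (@cvg_slack b b) (@cvg_slack b (~~ b)) (@near_distinct K).
apply: cvg_trans; apply: near_eq_cvg; near=> n; rewrite integral_step_fun//.
by move=> t; rewrite /masked; case: ifP => // _; exact: contact_cell_ge0.
Unshelve. all: by end_near. Qed.

Let k b : R := kappa l lU b.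
Let window_bound K : R := lU + (k true * fine (W K true) + k false * fine (W K false)).
Let total : \bar R := (lU%:E + ((k true)%:E * I true + (k false)%:E * I false))%E.

Let I_ge0 b : (0 <= I b)%E.
Proof. by apply: integral_ge0 => q _; rewrite lee_fin contact_ge0. Qed.

Let k_gt0 b : 0 < k b. Proof. exact: kappa_gt0. Qed.

Let window_boundE K : (window_bound K)%:E =
  (lU%:E + ((k true)%:E * W K true + (k false)%:E * W K false))%E.
Proof. rewrite -[W K true](fineK (window_integral_fin K true)).
by rewrite -[W K false](fineK (window_integral_fin K false)) -!EFinM -!EFinD. Qed.

Lemma window_bound_le K : ((window_bound K)%:E <= total)%E.
Proof.
rewrite window_boundE; apply: leeD => //; apply: leeD;
  by apply: lee_wpmul2l; rewrite ?lee_fin ?(ltW (k_gt0 _))//; exact: window_integral_le.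
Qed.

Lemma cvg_window_bound : (window_bound K)%:E @[K --> \oo] --> total.
Proof.
under eq_fun do rewrite window_boundE.
have C b : ((k b)%:E * W K b)%E @[K --> \oo] --> ((k b)%:E * I b)%E.
  by apply: cvgeZl => //; exact: cvg_window_integral.
have p b : (0 <= (k b)%:E * I b)%E by rewrite mule_ge0// lee_fin ltW.
apply: cvgeD; [|exact: cvg_cst|apply: cvgeD => //]; apply: ge0_adde_def; rewrite inE//.
- by rewrite lee_fin ltW.
- exact: adde_ge0.
Qed.

(** Fatou's lemma is used twice, for [K] outside and for [n] inside. For fixed [K] the expectations
    are bounded by a sequence converging to [window_bound K], which never exceeds [total]. *)
Lemma integral_pairs_le : (\int[P]_w pairs w <= total)%E.
Proof.
have [mbad Pbad] := bad_null l_gt0 lU_gt0 hPPP.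
have mU K n := (upper_expectation beta pw_gt0 l_gt0 lU_gt0 hPPP K n).1.
have mL K := measurable_limn_einf (mU K).
have U0 K n w : (0 <= upper_count_fun beta pw Phi U K n w)%E.
  by apply: sume_ge0 => j _; rewrite lee_fin.
have L0 K w : (0 <= limn_einf (fun n => upper_count_fun beta pw Phi U K n w))%E.
  by apply: le_limn_einf; apply: nearW => n.
apply: (@le_trans _ _ (\int[P]_w
    limn_einf (fun K => limn_einf (fun n => upper_count_fun beta pw Phi U K n w)))%E).
  apply: (ae_le_lower_integral mbad Pbad) => //.
  - exact: (measurable_limn_einf mL).
  - by move=> w; apply: le_limn_einf; apply: nearW => K.
  - exact: pairs_le_liminf.
apply: (le_trans (fatou P measurableT mL (fun K w _ => L0 K w))).
apply: (limn_einf_le (v := cst total)); last exact: cvg_cst.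
move=> K; apply: (le_trans (fatou P measurableT (mU K) (fun n w _ => U0 K n w))).
apply: le_trans (window_bound_le K).
apply: (limn_einf_le (fun n => (upper_expectation beta pw_gt0 l_gt0 lU_gt0 hPPP K n).2)).
apply: cvg_EFin; first exact: nearW.
have C b : kappa l lU b * expR (3 * (l true + l false) * mesh R n ^+ 2) *
    upper_sum beta pw l b K n @[n --> \oo] --> k b * fine (W K b).
  apply: cvgM; last exact: cvg_upper_sum.
  rewrite -[X in _ --> X]mulr1; apply: cvgM; [exact: cvg_cst|exact: cvg_expR_mesh].
by apply: cvgD; [exact: cvg_cst|apply: cvgD; exact: C].
Qed.

(** Here the pointwise bound holds at every [n], so that it suffices to let [n] grow in the explicit
    lower bounds for the expectations, and then [K]. *)
Lemma integral_pairs_ge : (total <= \int[P]_w pairs w)%E.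
Proof.
have [mbad Pbad] := bad_null l_gt0 lU_gt0 hPPP.
have step K : (2 <= K)%N -> ((window_bound K)%:E <= \int[P]_w pairs w)%E.
  move=> K2.
  have lower_ge0 n w : (0 <= lower_count_fun beta pw Phi U K n w)%E.
    by apply: sume_ge0 => j _; rewrite lee_fin.
  have E n := lower_expectation beta pw_gt0 l_gt0 lU_gt0 hPPP n K2.
  have L n := le_trans (E n).2 (ae_ge_lower_integral mbad Pbad (E n).1
    (lower_ge0 n) pairs_ge0 (@lower_le_pairs K n)).
  have C b : kappa l lU b * expR (- ((l b + 2 * lU) * mesh R n ^+ 2)) *
      lower_sum beta pw l b K n @[n --> \oo] --> k b * fine (W K b).
    apply: cvgM; last exact: cvg_lower_sum.
    rewrite -[X in _ --> X]mulr1; apply: cvgM; first exact: cvg_cst.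
    by under eq_fun do rewrite -mulNr; exact: cvg_expR_mesh.
  have D : (lU * expR (- (lU * mesh R n ^+ 2)) +
    (kappa l lU true * expR (- ((l true + 2 * lU) * mesh R n ^+ 2)) * lower_sum beta pw l true K n +
     kappa l lU false * expR (- ((l false + 2 * lU) * mesh R n ^+ 2)) *
       lower_sum beta pw l false K n))%:E @[n --> \oo] --> (window_bound K)%:E.
    apply: cvg_EFin; first exact: nearW.
    apply: cvgD; last by apply: cvgD; exact: C.
    rewrite -[X in _ --> X]mulr1; apply: cvgM; first exact: cvg_cst.
    by under eq_fun do rewrite -mulNr; exact: cvg_expR_mesh.
  rewrite -(cvg_lim _ D)//; apply: lime_le; first by apply/cvg_ex; exists (window_bound K)%:E.
  by apply: nearW => n; exact: L.
rewrite -(cvg_lim _ cvg_window_bound)//; apply: lime_le.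
  by apply/cvg_ex; exists total; exact: cvg_window_bound.
by exists 2%N => // K /= K2; exact: step.
Qed.

Lemma integral_pairs : (\int[P]_w pairs w)%E = total.
Proof. by apply/eqP; rewrite eq_le integral_pairs_le integral_pairs_ge. Qed.

End mean_served_pairs.

(** * Normalisation and the final formula *)

Lemma palm_normalize (R : realType) (c a b : R) (x y : \bar R) :
  0 < c -> 0 <= a -> 0 <= b -> (0 <= x)%E -> (0 <= y)%E ->
  (c^-1%:E * (c%:E + ((a * c ^+ 2)%:E * x + (b * c ^+ 2)%:E * y)) =
   1 + (c * a)%:E * x + (c * b)%:E * y)%E.
Proof.
move=> c0 a0 b0 x0 y0.
have cancel z : c^-1 * (z * c ^+ 2) = c * z by field; rewrite gt_eqF.
have k0 z t : 0 <= z -> (0 <= t)%E -> (0 <= (z * c ^+ 2)%:E * t)%E.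
  by move=> z0 t0; rewrite mule_ge0// lee_fin mulr_ge0// exprn_ge0// ltW.
(* In the extended reals the product is distributed over sums of nonnegative terms, which allows
   infinite [x] and [y]. *)
rewrite ge0_muleDr ?adde_ge0 ?k0 ?lee_fin ?(ltW c0)// ge0_muleDr ?k0//.
by rewrite !muleA -!EFinM !cancel mulVf ?gt_eqF// addeA.
Qed.

Theorem theorem7 (R : realType) (d : measure_display) (Omega : measurableType d)
    (P : probability Omega R)
    (lamBS p Pmac Pmic beta lamSU : R)
    (hlamBS : 0 < lamBS) (hp0 : 0 < p) (hp1 : p < 1)
    (hPmac : 0 < Pmac) (hPmic : 0 < Pmic) (hbeta : 2 < beta)
    (hlamSU : 0 < lamSU)
    (Phimac Phimic Ustatic : Omega -> set (R * R))
    (hPPP : indep_hPPPs P (fun i : 'I_3 => nth (fun _ => set0) [:: Phimac; Phimic; Ustatic] i)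
              (fun i : 'I_3 => nth 0 [:: p * lamBS; (1 - p) * lamBS; lamSU] i)) :
  palmE P Phimac Phimic Ustatic lamSU (users_in_cell0 beta Pmac Pmic) =
  (1 +
   (lamSU * lamBS * p)%:E *
     \int[@leb4 R]_xy
       (expR (- (lamBS * p) * union_area 1 xy.1 xy.2) *
        expR (- (lamBS * (1 - p)) *
              union_area ((Pmic / Pmac) `^ beta^-1) xy.1 xy.2))%:E +
   (lamSU * lamBS * (1 - p))%:E *
     \int[@leb4 R]_xy
       (expR (- (lamBS * (1 - p)) * union_area 1 xy.1 xy.2) *
        expR (- (lamBS * p) *
              union_area ((Pmac / Pmic) `^ beta^-1) xy.1 xy.2))%:E)%E.
Proof.
(* The intensities are commuted into the form in which they occur in the exponents of the
   conclusion. *)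
have hPPP' := hPPP; rewrite [p * _]mulrC [(1 - p) * _]mulrC in hPPP'.
pose Phi b := if b then Phimac else Phimic.
pose pw b := if b then Pmac else Pmic.
pose l b := if b then lamBS * p else lamBS * (1 - p).
have beta_gt0 : 0 < beta by apply: lt_trans hbeta.
have pw_gt0 b : 0 < pw b by case: b.
have l_gt0 b : 0 < l b by case: b; rewrite mulr_gt0// subr_gt0.
have -> : palmE P Phimac Phimic Ustatic lamSU (users_in_cell0 beta Pmac Pmic) =
    (lamSU^-1%:E * \int[P]_w
      \esum_(q in served_pairs beta pw (fun b => Phi b w) (Ustatic w)) 1)%E.
  congr (_ * _)%E; apply: eq_integral => w _; rewrite palm_sumE.
  by congr (esum (served_pairs _ _ _ _) _); apply/funext; case.
rewrite (@integral_pairs R d Omega P beta pw Phi Ustatic l lamSU)//=.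
have I_ge0 a b c : (0 <= contact_integral a b c :> \bar R)%E.
  by apply: integral_ge0 => xy _; rewrite lee_fin mulr_ge0 ?expR_ge0.
rewrite /kappa palm_normalize ?I_ge0// ?(ltW (l_gt0 _))//.
by rewrite !(mulrA lamSU).
Qed.
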